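(* Let $d\ge2$, let $Y$ be a closed parallelepiped of $\mathbb{R}^d$, and let $u\in C^3(\mathbb{R}^d)$ be such that $\nabla u$ is $Y$-periodic, $\langle\nabla u\rangle\neq0$, and $\nabla u\neq0$ everywhere in $\mathbb{R}^d$. Let $X(t,x)$ and $\tau(x)$ be the gradient flow of $u$ and the time to reach the equipotential $\{u=0\}$, as defined in the context. (1) If there exists a constant $C>0$ such that $$(\ast)\qquad \forall\,x\in\mathbb{R}^d,\quad \left|\int_0^{\tau(x)}\Delta u\big(X(t,x)\big)\,dt\right|\le C,$$ then the gradient field $\nabla u$ is isotropically realizable with a positive conductivity $\sigma\in L^\infty_\sharp(Y)$ such that $\sigma^{-1}\in L^\infty_\sharp(Y)$. (2) Conversely, if $\nabla u$ is isotropically realizable with a positive conductivity $\sigma\in C^1_\sharp(Y)$, then there exists a constant $C>0$ such that $(\ast)$ holds.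
   Context: $\langle\cdot\rangle$ denotes the average over $Y$. $L^\infty_\sharp(Y)$ is the space of $Y$-periodic functions in $L^\infty(\mathbb{R}^d)$, and $C^1_\sharp(Y)$ the space of $Y$-periodic $C^1$ functions on $\mathbb{R}^d$. For $x\in\mathbb{R}^d$, $X(\cdot,x)$ is the solution of $\frac{dX}{dt}(t,x)=\nabla u\big(X(t,x)\big)$ for $t\in\mathbb{R}$, with $X(0,x)=x$. Under the assumptions on $u$, for every $x\in\mathbb{R}^d$ there is a unique real number $\tau(x)$ such that $u\big(X(\tau(x),x)\big)=0$; this defines $\tau$. $\nabla u$ is isotropically realizable with a positive scalar conductivity $\sigma$ if $\operatorname{div}(\sigma\nabla u)=0$ in the sense of distributions on $\mathbb{R}^d$. *)

(* Defs.v *)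
From HB Require Import structures.
From mathcomp Require Import all_boot all_order all_algebra.
From mathcomp Require Import all_classical all_reals all_analysis.
Import Order.TTheory GRing.Theory Num.Theory.
Import numFieldNormedType.Exports.

Set Implicit Arguments.
Unset Strict Implicit.
Unset Printing Implicit Defensive.

Local Open Scope classical_set_scope.
Local Open Scope ring_scope.

(** R^n is ['rV[R]_n].  Its sigma-algebra is the product of n copies of the
    Borel sigma-algebra of R, which is the Borel sigma-algebra of R^n. *)

Definition rV_display : measure_display.
Proof. exact: default_measure_display. Qed.

Section rV_measurable.
Context (R : realType) (n : nat).

Definition rV_coord (i : 'I_n) (x : 'rV[R]_n) : measurableTypeR R := x 0 i.

Let rV_set0 : g_sigma_preimage rV_coord set0.
Proof. exact: sigma_algebra0. Qed.

Let rV_setC A : g_sigma_preimage rV_coord A -> g_sigma_preimage rV_coord (~` A).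
Proof. exact: sigma_algebraC. Qed.

Let rV_bigcup (F : (set 'rV[R]_n)^nat) :
  (forall i, g_sigma_preimage rV_coord (F i)) ->
  g_sigma_preimage rV_coord (\bigcup_i (F i)).
Proof. exact: sigma_algebra_bigcup. Qed.

HB.instance Definition _ := @isMeasurable.Build rV_display 'rV[R]_n
  (g_sigma_preimage rV_coord) rV_set0 rV_setC rV_bigcup.

Lemma measurable_rV_coord (i : 'I_n) : measurable_fun [set: 'rV[R]_n] (rV_coord i).
Proof.
move=> _ Y mY; rewrite setTI; apply: sub_sigma_algebra => /=.
rewrite -bigcup_seq/=; exists i => /=; first by rewrite mem_index_enum.
by exists Y => //; rewrite setTI.
Qed.

Lemma measurable_fun_rVP d (T : measurableType d) (f : T -> 'rV[R]_n) :
  (forall i, measurable_fun [set: T] (rV_coord i \o f)) ->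
  measurable_fun [set: T] f.
Proof.
move=> mf _ A mA; rewrite setTI.
suff: g_sigma_preimage (fun i => rV_coord i \o f) `<=` measurable.
  by apply; rewrite g_sigma_preimage_comp; exists A => //; rewrite setTI.
apply: smallest_sub; first exact: sigma_algebra_measurable.
rewrite -bigcup_seq; apply: bigcup_sub => i _.
by move=> B [C mC <-]; exact: mf.
Qed.

End rV_measurable.

Section rV_cons.
Context (R : realType) (n : nat).

Definition rV_cons (p : measurableTypeR R * 'rV[R]_n) : 'rV[R]_n.+1 :=
  row_mx (p.1%:M : 'rV[R]_1) p.2.

Definition rV_uncons (x : 'rV[R]_n.+1) : measurableTypeR R * 'rV[R]_n :=
  (x 0 0, rsubmx (x : 'rV[R]_(1 + n))).

Lemma rV_consK : cancel rV_cons rV_uncons.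
Proof.
move=> [a v]; rewrite /rV_uncons /rV_cons /=; congr pair; last exact: row_mxKr.
rewrite (_ : 0 = lshift n (0 : 'I_1) :> 'I_(1 + n)); last exact/val_inj.
by rewrite [LHS]row_mxEl mxE.
Qed.

Lemma rV_unconsK : cancel rV_uncons rV_cons.
Proof.
move=> x; rewrite /rV_uncons /rV_cons /= -[RHS](@hsubmxK _ _ 1 n).
have <- : (x 0 0)%:M = lsubmx (x : 'rV[R]_(1 + n)) => //.
apply/rowP => i; rewrite !mxE !ord1 eqxx mulr1n; congr (x _ _).
exact/val_inj.
Qed.

Lemma measurable_rV_cons : measurable_fun [set: _ * _] rV_cons.
Proof.
apply: measurable_fun_rVP => i.
case: (split_ordP (i : 'I_(1 + n))) => j ->.
  rewrite (_ : _ \o _ = fst) ?ord1; first exact: measurable_fst.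
  by apply/funext => p; rewrite /rV_coord /rV_cons /= [LHS]row_mxEl mxE.
rewrite (_ : _ \o _ = rV_coord j \o snd).
  by apply: measurableT_comp => //; exact: measurable_rV_coord.
by apply/funext => p; rewrite /rV_coord /rV_cons /= [LHS]row_mxEr.
Qed.

Lemma measurable_rV_uncons : measurable_fun [set: 'rV[R]_n.+1] rV_uncons.
Proof.
apply/measurable_fun_pairP; split; first exact: (@measurable_rV_coord _ _ 0).
apply: measurable_fun_rVP => i.
rewrite (_ : _ \o _ = rV_coord (rshift 1 i : 'I_n.+1)).
  exact: measurable_rV_coord.
by apply/funext => x; rewrite /rV_coord /= mxE.
Qed.

End rV_cons.

Section rV_cons_measure.
Context (R : realType) (n : nat).
Variable mu : {sigma_finite_measure set 'rV[R]_n -> \bar R}.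

Definition rV_cons_measure : set 'rV[R]_n.+1 -> \bar R :=
  pushforward (@lebesgue_measure R \x mu)%E (@rV_cons R n).

Let rV_cons_measure0 : rV_cons_measure set0 = 0%E.
Proof. by rewrite /rV_cons_measure /pushforward preimage_set0 measure0. Qed.

Let rV_cons_measure_ge0 A : (0 <= rV_cons_measure A)%E.
Proof. by rewrite /rV_cons_measure /pushforward; apply: measure_ge0. Qed.

Let rV_cons_measure_sigma_additive : semi_sigma_additive rV_cons_measure.
Proof.
have mK A : measurable A -> measurable (@rV_cons R n @^-1` A).
  by move=> mA; rewrite -[X in measurable X]setTI; exact: measurable_rV_cons.
move=> F mF tF mUF; rewrite /rV_cons_measure /pushforward preimage_bigcup.
apply: measure_semi_sigma_additive.
- by move=> k; exact: mK.
- apply/trivIsetP => /= i j _ _ ij; rewrite -preimage_setI.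
  by move/trivIsetP : tF => /(_ _ _ _ _ ij) ->//; rewrite preimage_set0.
- by rewrite -preimage_bigcup; exact: mK.
Qed.

HB.instance Definition _ := isMeasure.Build _ _ _ rV_cons_measure
  rV_cons_measure0 rV_cons_measure_ge0 rV_cons_measure_sigma_additive.

Let rV_cons_measure_sigma_finite : sigma_finite setT rV_cons_measure.
Proof.
have /sigma_finiteP[F [TF ndF Foo]] := sigma_finiteT (@lebesgue_measure R).
have /sigma_finiteP[G [TG ndG Goo]] := sigma_finiteT mu.
exists (fun k => @rV_uncons R n @^-1` (F k `*` G k)).
  apply/seteqP; split=> // x _.
  have [i _ Fi] : (\bigcup_i F i) (x 0 0) by rewrite -TF.
  have [j _ Gj] : (\bigcup_i G i) (rsubmx (x : 'rV[R]_(1 + n))) by rewrite -TG.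
  exists (maxn i j) => //; split => /=.
    by move: Fi; exact/subsetPset/ndF/leq_maxl.
  by move: Gj; exact/subsetPset/ndG/leq_maxr.
move=> k; have [mFk Fkoo] := Foo k; have [mGk Gkoo] := Goo k; split.
  rewrite -[X in measurable X]setTI; apply: measurable_rV_uncons => //.
  exact: measurableX.
rewrite /rV_cons_measure /pushforward -comp_preimage.
rewrite (_ : _ \o _ = id) ?preimage_id; last first.
  by apply/funext => p /=; rewrite rV_consK.
by rewrite product_measure1E// lte_mul_pinfty// ge0_fin_numE.
Qed.

HB.instance Definition _ := @Measure_isSigmaFinite.Build _ _ _ rV_cons_measure
  rV_cons_measure_sigma_finite.

End rV_cons_measure.

Fixpoint rV_lebesgue_rec (R : realType) (n : nat) :
    {sigma_finite_measure set 'rV[R]_n -> \bar R} :=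
  match n with
  | 0 => \d_(0 : 'rV[R]_0)
  | m.+1 => rV_cons_measure (rV_lebesgue_rec R m)
  end.

(** Lebesgue measure on R^n: the n-fold product of the one-dimensional one. *)
Definition rV_lebesgue (R : realType) (n : nat) : set 'rV[R]_n -> \bar R :=
  rV_lebesgue_rec R n.

HB.instance Definition _ (R : realType) (n : nat) :=
  SigmaFiniteMeasure.copy (@rV_lebesgue R n) (rV_lebesgue_rec R n).

Lemma rV_lebesgue_box (R : realType) (n : nat) (a b : 'rV[R]_n) :
  (forall i, a 0 i <= b 0 i) ->
  rV_lebesgue [set x : 'rV[R]_n | forall i, a 0 i <= x 0 i <= b 0 i] =
  (\prod_(i < n) (b 0 i - a 0 i))%:E.
Proof.
elim: n a b => [|n IH] a b ab.
  rewrite big_ord0 /rV_lebesgue /= diracE mem_set//.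
  by move=> [].
rewrite /rV_lebesgue /= /rV_cons_measure /pushforward.
pose a' := rsubmx (a : 'rV[R]_(1 + n)); pose b' := rsubmx (b : 'rV[R]_(1 + n)).
have l0 (c : 'rV[R]_n.+1) i : rsubmx (c : 'rV[R]_(1 + n)) 0 i = c 0 (lift 0 i).
  by rewrite mxE; congr (c _ _); apply/val_inj.
have c0 p : @rV_cons R n p 0 0 = p.1 by have /(congr1 fst) := rV_consK p.
have cS p i : @rV_cons R n p 0 (lift 0 i) = p.2 0 i.
  by rewrite -l0; have /(congr1 snd)/= -> := rV_consK p.
set B := [set x : 'rV[R]_n | forall i, a' 0 i <= x 0 i <= b' 0 i].
have -> : @rV_cons R n @^-1`
    [set x : 'rV[R]_n.+1 | forall i, a 0 i <= x 0 i <= b 0 i] =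
    `[a 0 0, b 0 0]%classic `*` B.
  apply/seteqP; split=> -[t v] /=.
    move=> h; split; first by have := h 0; rewrite c0 /= in_itv.
    by move=> i; have := h (lift 0 i); rewrite cS /a' /b' !l0.
  move=> [+ h] i; rewrite in_itv /= => h0.
  case: (unliftP 0 i) => [j ->|->]; last by rewrite c0.
  by have := h j; rewrite cS /a' /b' !l0.
have mB : measurable B.
  rewrite (_ : B = \bigcap_(i in [set: 'I_n])
      (@rV_coord R n i @^-1` `[a' 0 i, b' 0 i]%classic)).
    apply: fin_bigcap_measurable => // i _; rewrite -[X in measurable X]setTI.
    exact: measurable_rV_coord.
  apply/seteqP; split=> x /= h i; first by move=> _; rewrite /= in_itv /= h.
  by have := h i I; rewrite /= in_itv.
have E0 : (@lebesgue_measure R) `[a 0 0, b 0 0]%classic = (b 0 0 - a 0 0)%:E.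
  rewrite lebesgue_measure_itv/= lte_fin.
  have [_|ba] := ltP (a 0 0) (b 0 0); first by rewrite EFinB.
  by have /eqP -> : b 0 0 == a 0 0; rewrite ?subrr// eq_le ba ab.
have EB : rV_lebesgue B = (\prod_(i < n) (b' 0 i - a' 0 i))%:E.
  by apply: IH => i; rewrite !l0.
rewrite product_measure1E// big_ord_recl EFinM.
congr (_ * _)%E; first exact: E0.
apply: (etrans EB); congr EFin; apply: eq_bigr => i _; rewrite !l0//.
Qed.

Section calculus.
Context (R : realType) (d : nat).
Implicit Types (u f : 'rV[R]_d -> R) (E : 'rV[R]_d -> 'rV[R]_d).

Definition partial (i : 'I_d) f : 'rV[R]_d -> R := fun x => 'D_('e_i) f x.

Fixpoint Ck (k : nat) f : Prop :=
  match k with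
  | 0 => continuous f
  | l.+1 => (forall x, differentiable f x) /\ (forall i, Ck l (partial i f))
  end.

Definition Cinfty f := forall k, Ck k f.

Definition grad u : 'rV[R]_d -> 'rV[R]_d := fun x => \row_i partial i u x.

Definition laplacian u : 'rV[R]_d -> R :=
  fun x => \sum_i partial i (partial i u) x.

Definition dotp (v w : 'rV[R]_d) : R := \sum_i v 0 i * w 0 i.

Definition compactly_supported f := compact (closure [set x | f x != 0]).

(** The scalar conductivity [sigma] realizes the field [E] when
    div (sigma E) = 0 in the sense of distributions on R^d. *)
Definition isotropically_realizable E (sigma : 'rV[R]_d -> R) :=
  forall phi, Cinfty phi -> compactly_supported phi ->
    \int[@rV_lebesgue R d]_x (sigma x * dotp (E x) (grad phi x)) = 0.

End calculus.

Section periodic.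
Context (R : realType) (d : nat).

(** The parallelepiped with vertex [a] whose edges are the rows of [B]; it is
    nondegenerate when [B \in unitmx]. *)
Definition parallelepiped (a : 'rV[R]_d) (B : 'M[R]_d) : set 'rV[R]_d :=
  [set x | exists2 s : 'rV[R]_d,
     (forall i, 0 <= s 0 i <= 1) & x = a + s *m B].

(** Periodicity along each edge, hence along the lattice they generate. *)
Definition Y_periodic (T : Type) (B : 'M[R]_d) (f : 'rV[R]_d -> T) :=
  forall x i, f (x + row i B) = f x.

Definition average (Y : set 'rV[R]_d) (E : 'rV[R]_d -> 'rV[R]_d) : 'rV[R]_d :=
  \row_i ((fine (rV_lebesgue Y))^-1 * \int[@rV_lebesgue R d]_(x in Y) E x 0 i).

(** L^oo_#(Y), an element of which is given by a representative that is
    periodic at every point. *)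
Definition Linfty_per (B : 'M[R]_d) (f : 'rV[R]_d -> R) :=
  [/\ measurable_fun [set: 'rV[R]_d] (f : 'rV[R]_d -> measurableTypeR R),
      ('N[@rV_lebesgue R d]_+oo [EFin \o f] < +oo)%E & Y_periodic B f].

Definition C1_per (B : 'M[R]_d) (f : 'rV[R]_d -> R) := Ck 1 f /\ Y_periodic B f.

End periodic.

Section flow.
Context (R : realType) (d : nat).

Definition is_gradient_flow (u : 'rV[R]_d -> R) (X : R -> 'rV[R]_d -> 'rV[R]_d) :=
  forall x, X 0 x = x /\
    forall t : R, is_derive t (1 : R) (X ^~ x : R -> 'rV[R]_d) (grad u (X t x)).

(** The oriented integral of [f] from [a] to [b], where [b < a] is allowed. *)
Definition oriented_integral (a b : R) (f : R -> R) : R :=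
  if a <= b then \int[@lebesgue_measure R]_(t in `[a, b]) f t
  else - \int[@lebesgue_measure R]_(t in `[b, a]) f t.

End flow.

(* Main.v *)
From HB Require Import structures.
Require Import Defs.
From mathcomp Require Import all_boot all_order all_algebra.
From mathcomp Require Import all_classical all_reals all_analysis.
From mathcomp Require Import ring lra.
Import Order.TTheory GRing.Theory Num.Theory.
Import numFieldNormedType.Exports.

Set Implicit Arguments.
Unset Strict Implicit.
Unset Printing Implicit Defensive.

Local Open Scope classical_set_scope.
Local Open Scope ring_scope.

(** Write [A(t, x)] for the integral of [laplacian u] along the flow line of [x]
    from time [0] to [t].

    (1) Since [tau (X t x) = tau x - t], the hypothesis bounds [A] by [2C] at all
    times.  Then [sigma x = exp (sup_t A(t, x))] is bounded above and below,
    inherits the periodicity of [grad u], and satisfies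
    [sigma (X t x) = exp (- A(t, x)) * sigma x], the integrated form of
    [div (sigma grad u) = 0].  To get the equation in the sense of distributions
    although [sigma] is only measurable, replace the supremum by that of
    [A(t, x) - e |t|], which is Lipschitz in [x] and satisfies the flow identity up
    to an error [e |t|], and let [e] tend to [0].  For Lipschitz [g] with compact
    support, the integral of [g (x + h grad u x) - g x] is
    [- h] times that of [g * laplacian u] up to [O(h^2)], because a displacement
    along [h grad u] is, up to [O(h^2)], a composition of shears along the axes,
    to which the one-dimensional change of variables applies.

    (2) Testing the equation against bump functions gives it pointwise, so
    [sigma (X t x) * exp A(t, x)] does not depend on [t], and
    [A(tau x, x) = ln (sigma x) - ln (sigma (X (tau x) x))] is bounded because
    [ln sigma] is continuous and periodic. *)

(** The natural candidate [exp (A (tau x, x))] satisfies the flow identity but is in general not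
    periodic: [grad u] is periodic while [u] need not be, so the level set [u = 0] is not invariant
    under the lattice. The supremum over all times refers to no level set, at the cost of
    regularity: flow lines may separate exponentially, so a Lipschitz constant of [A (t, x)] in [x]
    is available only for bounded [t]. Since time [0] contributes [0] and [A] is at most [2C], the
    penalty [e |t|] makes times beyond [2C / e] irrelevant.

    The order of the limits matters. At fixed [e] the errors in [h^2] involve the Lipschitz constant
    of the penalized supremum, which is not controlled as [e] tends to [0]; so [h] tends to [0]
    first. What remains is a flux of size at most [K e] with [K] independent of [e]. *)

(** * Mean value inequalities for functions of one variable *)

Section one_variable.
Context {R : realType}.
Implicit Types (f df : R -> R) (a b t : R).

Lemma is_derive_continuous (V : normedModType R) (f df : R -> V) :
  (forall t, is_derive t (1 : R) f (df t)) -> continuous f.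
Proof.
move=> fdf t; apply: differentiable_continuous; apply/derivable1_diffP.
by have [] := fdf t.
Qed.

Lemma derive_bound f df K a b : a <= b ->
  (forall t, a <= t <= b -> is_derive t 1 f (df t)) ->
  (forall t, a <= t <= b -> `|df t| <= K) ->
  `|f b - f a| <= K * (b - a).
Proof.
move=> ab fdf dfK.
have [||c cab ->] := @MVT_segment R f df a b ab.
- by move=> x; rewrite in_itv /= => /andP[/ltW ax /ltW xb]; apply: fdf;
  rewrite ax.
- apply: derivable_within_continuous => x; rewrite in_itv /= => xab.
  by have [] := fdf x xab.
rewrite normrM [`|b - a|]ger0_norm ?subr_ge0// ler_wpM2r ?subr_ge0//.
exact: dfK.
Qed.

Lemma derive_bound_sym f df K T : (forall t, is_derive t 1 f (df t)) ->
  (forall t, `|t| <= T -> `|df t| <= K) ->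
  forall t, `|t| <= T -> `|f t - f 0| <= K * `|t|.
Proof.
move=> fdf dfK t tT; have [t0|/ltW t0] := leP 0 t.
  rewrite (ger0_norm t0) -[t in X in _ <= X]subr0; apply: derive_bound => // s.
  move=> /andP[s0 st]; apply: dfK; rewrite ger0_norm//.
  by apply: le_trans tT; rewrite ger0_norm.
rewrite distrC (ler0_norm t0) -[- t]sub0r; apply: derive_bound => // s.
move=> /andP[st s0]; apply: dfK; rewrite ler0_norm//.
by apply: le_trans tT; rewrite ler0_norm// lerN2.
Qed.

Lemma derive_ge0_nondecreasing f df : (forall t, is_derive t 1 f (df t)) ->
  (forall t, 0 <= df t) -> {homo f : s t / s <= t}.
Proof.
move=> fdf df0 s t st.
have cf : {within `[s, t], continuous f}.
  exact/continuous_subspaceT/(is_derive_continuous fdf).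
have [c _ E] := MVT_segment st (fun x _ => fdf x) cf.
by rewrite -subr_ge0 E mulr_ge0// subr_ge0.
Qed.

Lemma derive_gt0_increasing f df : (forall t, is_derive t 1 f (df t)) ->
  (forall t, 0 < df t) -> {homo f : s t / s < t}.
Proof.
move=> fdf df0 s t st.
have cf : {within `[s, t], continuous f}.
  exact/continuous_subspaceT/(is_derive_continuous fdf).
have [c _ E] := MVT st (fun x _ => fdf x) cf.
by rewrite -subr_gt0 E mulr_gt0// subr_gt0.
Qed.

Lemma derive_eq0_constant f : (forall t, is_derive t 1 f 0) ->
  forall s t, f s = f t.
Proof.
move=> f0; suff H s t : s <= t -> f s = f t.
  by move=> s t; have [/H//|/ltW/H//] := leP s t.
move=> st; have := @derive_bound f (cst 0) 0 s t st (fun r _ => f0 r).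
rewrite mul0r normr_le0 subr_eq0 => /(_ _)/eqP -> // r _.
by rewrite normr0.
Qed.

End one_variable.

Lemma is_derive_along (R : realType) (d : nat) (f : 'rV[R]_d -> R)
    (Y : R -> 'rV[R]_d) (t : R) (v : 'rV[R]_d) :
  differentiable f (Y t) -> is_derive t 1 Y v ->
  is_derive t 1 (f \o Y) (dotp (grad f (Y t)) v).
Proof.
move=> df [dY Yv]; have dY' : differentiable Y t by exact/derivable1_diffP.
have dfY : differentiable (f \o Y) t by exact: differentiable_comp.
apply: DeriveDef; first exact/derivable1_diffP.
rewrite deriveE// diff_comp//= -(deriveE _ dY') Yv [v in LHS]row_sum_delta
  linear_sum.
apply: eq_bigr => i _; rewrite linearZ /= -deriveE//.
by rewrite !mxE mulrC /partial.
Qed.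

Lemma is_derive_coord (R : realType) (d : nat) (Y : R -> 'rV[R]_d) (t : R)
    (v : 'rV[R]_d) (i : 'I_d) :
  is_derive t 1 Y v -> is_derive t 1 (fun s => Y s 0 i) (v 0 i).
Proof.
move=> [dY Yv]; apply: DeriveDef; first by move/derivable_mxP : dY; exact.
by rewrite -Yv derive_mx// mxE.
Qed.

(** * Maximum norm and Lipschitz bounds in several variables *)

Section several_variables.
Context {R : realType} {d : nat}.
Implicit Types (f : 'rV[R]_d -> R) (x y v : 'rV[R]_d).

Lemma is_derive_line x v (t : R) : is_derive t 1 (fun s : R => x + s *: v) v.
Proof.
have dv : is_diff t (fun s : R => s *: v) ( *:%R^~ v) by exact: is_diff_scalel.
have d1 : is_derive t 1 (fun s : R => s *: v) v.
  apply: DeriveDef; first exact/derivable1_diffP.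
  by rewrite deriveE// diff_val scale1r.
by have := is_deriveD (is_derive_cst x t 1) d1; rewrite add0r.
Qed.

Lemma norm_coord_le x (i : 'I_d) : `|x 0 i| <= `|x|.
Proof. 
by rewrite [leRHS]/Num.Def.normr/= mx_normrE; exact: (le_bigmax _ _ (0, i)).
Qed.

Lemma norm_le_coord x (K : R) : 0 <= K -> (forall i, `|x 0 i| <= K) ->
  `|x| <= K.
Proof.
move=> K0 xK; rewrite [leLHS]/Num.Def.normr/= mx_normrE bigmax_le// =>
  -[i j] _ /=.
by rewrite ord1.
Qed.

(** The norm of a row vector is the maximum of its coordinates, so summing over the coordinates
    costs the factor [d]; this is where the powers of [d] in later constants come from. *)
Lemma normr_dotp_le x y (K : R) : (forall i, `|x 0 i| <= K) ->
  `|dotp x y| <= d%:R * K * `|y|.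
Proof.
move=> xK; apply: le_trans (ler_norm_sum _ _ _) _.
rewrite -mulrA -[d in d%:R]card_ord mulr_natl -sumr_const; apply: ler_sum =>
  i _.
by rewrite normrM ler_pM// norm_coord_le.
Qed.

Lemma bounded_grad_lipschitz f (K : R) : (forall x, differentiable f x) ->
  (forall i x, `|partial i f x| <= K) ->
  forall x y, `|f x - f y| <= d%:R * K * `|x - y|.
Proof.
move=> df fK x y.
have fl t := is_derive_along (df _) (is_derive_line y (x - y) t).
have := @derive_bound R _ _ (d%:R * K * `|x - y|) 0 1 ler01 (fun t _ => fl t).
rewrite /= scale1r scale0r addr0 subrKC subr0 mulr1; apply => t _.
by apply: normr_dotp_le => i; rewrite mxE.
Qed.

End several_variables.

(** * Pointwise operations on continuous functions *)

Section continuous_real_functions.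
Context {R : realType} {T : topologicalType}.
Implicit Types f g : T -> R.

Lemma continuous_mul f g : continuous f -> continuous g ->
  continuous (fun x => f x * g x).
Proof. by move=> cf cg x; apply: cvgM; [exact: cf|exact: cg]. Qed.

Lemma continuous_add f g : continuous f -> continuous g ->
  continuous (fun x => f x + g x).
Proof. by move=> cf cg x; apply: cvgD; [exact: cf|exact: cg]. Qed.

Lemma continuous_sub f g : continuous f -> continuous g ->
  continuous (fun x => f x - g x).
Proof. by move=> cf cg x; apply: cvgB; [exact: cf|exact: cg]. Qed.

Lemma continuous_cst (c : R) : continuous (fun _ : T => c).
Proof. by move=> x; exact: cvg_cst. Qed.

Lemma continuous_sum (I : Type) (r : seq I) (P : pred I) (F : I -> T -> R) :
  (forall i, continuous (F i)) -> continuous (fun x =>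
    \sum_(i <- r | P i) F i x).
Proof.
move=> cF; elim: r => [|i r IH].
  by rewrite (_ : (fun x => _) = fun=> 0); [exact: continuous_cst|
    apply/funext => x; rewrite big_nil].
have [Pi|Pi] := boolP (P i); last first.
  rewrite (_ : (fun x => _) = fun x => \sum_(i <- r | P i) F i x) //.
  by apply/funext => x; rewrite big_cons (negbTE Pi).
rewrite (_ : (fun x => _) = fun x => F i x + \sum_(i <- r | P i) F i x).
  exact: continuous_add.
by apply/funext => x; rewrite big_cons Pi.
Qed.

Lemma continuous_fun_comp (U : topologicalType) (p : U -> T) f :
  continuous p -> continuous f -> continuous (fun x => f (p x)).
Proof. by move=> cp cf x; apply: continuous_comp; [exact: cp|exact: cf]. Qed.

End continuous_real_functions.

Lemma lipschitz_continuous (R : realType) (V W : normedModType R) (f : V -> W)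
    (K : R) : (forall x y, `|f x - f y| <= K * `|x - y|) -> continuous f.
Proof.
move=> fK x; apply/cvgrPdist_le => e e0.
have K0 : 0 < `|K| + 1 by rewrite ltr_wpDl.
near=> y; rewrite (le_trans (fK _ _))//.
rewrite (@le_trans _ _ ((`|K| + 1) * `|x - y|))//.
  by rewrite ler_wpM2r// (le_trans (ler_norm K))// lerDl.
rewrite -ler_pdivlMl// mulrC ltW//.
by near: y; apply: cvgr_dist_lt => //; rewrite divr_gt0.
Unshelve. all: by end_near. Qed.

(** * The fundamental theorem of calculus for oriented integrals *)

Section oriented_integral_FTC.
Context {R : realType}.
Implicit Types (f F : R -> R).

(** The antiderivative is local, on [|t| < N], so that it can be a primitive based at [- N], for
    which the derivative is known only to the right of [- N]. *)
Lemma oriented_integral_FTC2 f F (N a b : R) : continuous f ->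
  (forall t : R, `|t| < N -> is_derive t 1 F (f t)) -> `|a| < N -> `|b| < N ->
  oriented_integral a b f = F b - F a.
Proof.
move=> cf Ff.
have cF (t : R) : `|t| < N -> {for t, continuous F}.
  move=> tN; apply: differentiable_continuous; apply/derivable1_diffP.
  by have [] := Ff t tN.
have H s t : s < t -> `|s| < N -> `|t| < N ->
    \int[@lebesgue_measure R]_(x in `[s, t]) f x = F t - F s.
  move=> st sN tN.
  have stN x : s < x < t -> `|x| < N.
    move=> /andP[sx xt]; move: sN tN; rewrite !ltr_norml =>
      /andP[sN _] /andP[_ tN].
    by rewrite (lt_trans sN)// (lt_trans xt).
  rewrite /Rintegral (@continuous_FTC2 _ f F)//.
  - exact/continuous_subspaceT.
  - split.
    + by move=> x; rewrite in_itv /= => /stN/Ff[].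
    + exact/cvg_at_right_filter/cF.
    + exact/cvg_at_left_filter/cF.
  - by move=> x; rewrite in_itv /= => /stN/Ff ?; rewrite derive1E derive_val.
move=> aN bN; rewrite /oriented_integral; case: (ltgtP a b) => ab.
- exact: H.
- by rewrite H// opprB.
- by rewrite -ab set_itv1 Rintegral_set1 subrr.
Qed.

(** The definition by cases changes form at [0]. Near [t] it agrees with [H s - H 0] for the
    primitive [H] based at [- N], where [N = |t| + 1] leaves both [0] and a neighbourhood of [t]
    inside [|s| < N]. *)
Lemma is_derive_oriented_integral f (t : R) : continuous f ->
  is_derive t 1 (fun s => oriented_integral 0 s f) (f t).
Proof.
move=> cf; pose N : R := `|t| + 1.
pose H (x : R) := \int[@lebesgue_measure R]_(s in `[- N, x]) f s.
have N0 : 0 < N by rewrite ltr_wpDl.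
have tN : `|t| < N by rewrite ltrDl.
have Hf (x : R) : `|x| < N -> is_derive x 1 H (f x).
  rewrite ltr_norml => /andP[Nx xN].
  have [|||dH H'] := @continuous_FTC1_closed R f (- N) x N xN.
  - apply: continuous_compact_integrable; first exact: segment_compact.
    exact: continuous_subspaceT.
  - by rewrite Nx.
  - exact: cf.
  - by apply: DeriveDef; [exact: dH|rewrite -derive1E].
have E : \forall s \near t, H s - H 0 = oriented_integral 0 s f.
  have : nbhs t [set s : R | `|s| < N].
    apply: open_nbhs_nbhs; split => //.
    by apply: open_comp (@open_lt R N) => // s _; exact: norm_continuous.
  by apply: filterS => s sN; rewrite (oriented_integral_FTC2 cf Hf)// normr0.
apply: (@near_eq_is_derive _ _ _ (fun s => H s - H 0) _ _ _ _ E).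
by have := is_deriveB (Hf t tN) (is_derive_cst (H 0) t 1); rewrite subr0.
Qed.

End oriented_integral_FTC.

(** * Periodic functions *)

Section periodic_functions.
Context {R : realType} {d : nat} (B : 'M[R]_d).
Hypothesis Bunit : B \in unitmx.

Lemma Y_periodic_int (T : Type) (f : 'rV[R]_d -> T) (z : 'I_d -> int) x :
  Y_periodic B f -> f (x + (\row_i (z i)%:~R) *m B) = f x.
Proof.
move=> pf.
have pn (n : nat) i y : f (y + row i B *+ n) = f y.
  by elim: n => [|n IH]; rewrite ?mulr0n ?addr0// mulrSr addrA pf.
have pz (m : int) i y : f (y + row i B *~ m) = f y.
  case: m => n; first exact: pn.
  by rewrite NegzE -[in RHS](subrK (row i B *+ n.+1) y) pn mulrNz.
rewrite mulmx_sum_row.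
under eq_bigr => i _ do rewrite mxE scaler_int.
elim/big_rec : _ x => [x|i y _ IH x]; first by rewrite addr0.
by rewrite addrCA addrC pz IH.
Qed.

(** In the basis formed by the rows of [B], subtracting the integer parts of the coordinates brings
    any point into the image of the unit cube, which is compact. *)
Lemma continuous_periodic_bounded (f : 'rV[R]_d -> R) :
  continuous f -> Y_periodic B f -> exists K, forall x, `|f x| <= K.
Proof.
move=> cf pf; pose Q := [set s : 'rV[R]_d | forall i, `[0, 1]%classic (s 0 i)].
have cQ : compact Q.
  apply: (@rV_compact R d (fun=> `[0, 1]%classic)) => i; exact: segment_compact.
have cg : continuous (fun s : 'rV[R]_d => f (s *m B)).
  move=> s; apply: continuous_comp; last exact: cf.
  have [K BK] : exists K, forall i j, `|B i j| <= K.
    exists `|B| => i j; rewrite [leRHS]/Num.Def.normr/= mx_normrE.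
    exact: (le_bigmax _ _ (i, j)).
  apply: (@lipschitz_continuous _ _ _ _ (d%:R * `|K|)) => y z.
  apply: norm_le_coord => [|i]; first by rewrite !mulr_ge0.
  rewrite -mulmxBl (_ : (_ *m _) 0 i = dotp (col i B)^T (y - z)).
    by apply: normr_dotp_le => j; rewrite !mxE (le_trans (BK _ _))// ler_norm.
  by rewrite mxE; apply: eq_bigr => j _; rewrite mulrC !mxE.
have [K [_ KQ]] := compact_bounded (continuous_compact (continuous_subspaceT
  cg) cQ).
exists (K + 1) => x.
pose s := x *m invmx B; pose z i := Num.floor (s 0 i).
rewrite -(@Y_periodic_int _ f (fun i => - z i)) //.
have -> : x + (\row_i (- z i)%:~R) *m B = (\row_i (s 0 i - (z i)%:~R)) *m B.
  rewrite -[x in LHS](mulmxKV Bunit) -mulmxDl; congr (_ *m _).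
  by apply/rowP => i; rewrite !mxE rmorphN.
have K1 : K < K + 1 by rewrite ltrDl.
apply: (KQ (K + 1) K1).
exists (\row_i (s 0 i - (z i)%:~R)) => // i.
rewrite /= mxE in_itv /=; have := floor_itv (s 0 i).
by rewrite /z subr_ge0 => /andP[-> h]; rewrite lerBlDr (le_trans (ltW h))//
  intrD addrC.
Qed.

Lemma partial_periodic (f : 'rV[R]_d -> R) i :
  Y_periodic B f -> Y_periodic B (partial i f).
Proof.
move=> pf x j; rewrite /partial /derive.
rewrite (_ : (fun h : R => _) = fun h =>
    h^-1 *: ((f \o shift x) (h *: 'e_i) - f x)) //.
by apply/funext => h /=; rewrite addrA !pf.
Qed.

End periodic_functions.

(** * Ordinary differential equations *)

Section gronwall.
Context {R : realType}.

Lemma is_derive_expR_comp (g : R -> R) (t dg : R) :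
  is_derive t 1 g dg -> is_derive t 1 (fun s => expR (g s)) (dg * expR (g t)).
Proof. by move=> h; have := is_derive1_comp (is_derive_expR (g t)) h;
  rewrite mulrC. Qed.

Lemma is_derive_mul (f g : R -> R) (t df dg : R) :
  is_derive t 1 f df -> is_derive t 1 g dg ->
  is_derive t 1 (fun s => f s * g s) (df * g t + f t * dg).
Proof.
move=> hf hg; have := is_deriveM hf hg.
by move/is_derive_eq; apply; rewrite /GRing.scale /= addrC mulrC.
Qed.

Lemma is_derive_linear (c t : R) : is_derive t 1 (fun s => c * s) c.
Proof.
have := is_derive_mul (is_derive_cst c t 1) (is_derive_id t 1).
by rewrite mul0r add0r mulr1.
Qed.

(** For [t >= 0] the function [w s * expR (- K * s)] is nonincreasing; for [t <= 0] the function
    [w s * expR (K * s)] is nondecreasing. Both are compared with their value at [0]. *)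
Lemma gronwall (w dw : R -> R) (K : R) : (forall t : R,
  is_derive t 1 w (dw t)) ->
  (forall t, `|dw t| <= K * w t) -> forall t, w t <= w 0 * expR (K * `|t|).
Proof.
move=> wdw dwK t.
have wexp (c s : R) : is_derive s 1 (fun s => w s * expR (c * s))
    ((dw s + c * w s) * expR (c * s)).
  have := is_derive_mul (wdw s) (is_derive_expR_comp (is_derive_linear c s)).
  by move/is_derive_eq; apply; ring.
have [t0|/ltW t0] := leP 0 t.
  have wexpN (s : R) : is_derive s 1 (fun s => - (w s * expR (- K * s)))
    (- ((dw s + - K * w s) * expR (- K * s))) by exact: is_deriveN.
  have /(derive_ge0_nondecreasing wexpN)/(_ _ _ t0) :
      forall s, 0 <= - ((dw s + - K * w s) * expR (- K * s)).
    move=> s; rewrite -mulNr mulr_ge0 ?expR_ge0// mulNr opprB subr_ge0.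
    exact: le_trans (ler_norm _) (dwK s).
  by rewrite mulr0 expR0 mulr1 lerN2 mulNr expRN ler_pdivrMr ?expR_gt0//
    ger0_norm.
have /(derive_ge0_nondecreasing (wexp K))/(_ _ _ t0) :
    forall s, 0 <= (dw s + K * w s) * expR (K * s).
  move=> s; rewrite mulr_ge0 ?expR_ge0// -lerBlDr sub0r.
  by have := dwK s; rewrite ler_norml => /andP[].
by rewrite mulr0 expR0 mulr1 (ler0_norm t0) mulrN expRN ler_pdivlMr ?expR_gt0.
Qed.

End gronwall.

Section autonomous_ode.
Context {R : realType} {d : nat} (v : 'rV[R]_d -> 'rV[R]_d) (L : R).
Hypothesis L0 : 0 <= L.
Hypothesis vL : forall x y, `|v x - v y| <= L * `|x - y|.

Definition solution (Y : R -> 'rV[R]_d) :=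
  forall t : R, is_derive t (1 : R) Y (v (Y t)).

(** Growth rate of the sum of the squared coordinates of a difference of solutions: [2] from
    differentiating a square, [d] from bounding each of the [d] terms by the maximum norm. *)
Definition flow_rate : R := 2 * d%:R * L.

(** The maximum norm is not differentiable, so Gronwall's inequality is applied to the sum [w] of
    the squared coordinates of [Y - Z], which dominates the squared norm. *)
Lemma solution_dist Y Z : solution Y -> solution Z ->
  forall t, `|Y t - Z t| <= d%:R * `|Y 0 - Z 0| * expR (flow_rate * `|t|).
Proof.
move=> sY sZ t.
pose e i s := Y s 0 i - Z s 0 i; pose de i s := v (Y s) 0 i - v (Z s) 0 i.
have eE i s : is_derive s (1 : R) (e i) (de i s).
  exact: is_deriveB (is_derive_coord i (sY s)) (is_derive_coord i (sZ s)).
pose w s := \sum_i e i s * e i s.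
pose dw s := \sum_i (de i s * e i s + e i s * de i s).
have wdw (s : R) : is_derive s 1 w (dw s).
  have := @is_derive_sum _ _ _ _ (fun i s => e i s * e i s) s (1 : R)
    (fun i => de i s * e i s + e i s * de i s) (fun i =>
      is_derive_mul (eE i s) (eE i s)).
  by rewrite (_ : \sum_(i < d) _ = w) //; apply/funext => r; rewrite fct_sumE.
have coordE (x y : 'rV[R]_d) i : x 0 i - y 0 i = (x - y) 0 i by rewrite !mxE.
have ew i s : `|e i s| ^+ 2 <= w s.
  rewrite real_normK ?num_real// expr2 /w (bigD1 i) //= lerDl.
  by apply: sumr_ge0 => j _; rewrite -expr2 sqr_ge0.
have w0 s : 0 <= w s by apply: sumr_ge0 => j _; rewrite -expr2 sqr_ge0.
have nw s : `|Y s - Z s| ^+ 2 <= w s.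
  rewrite -[leRHS]sqr_sqrtr// lerXn2r ?nnegrE ?sqrtr_ge0//.
  apply: norm_le_coord; rewrite ?sqrtr_ge0// => i; rewrite -coordE.
  by rewrite -[leLHS]ger0_norm// -sqrtr_sqr ler_wsqrtr//; exact: ew.
have dwK s : `|dw s| <= flow_rate * w s.
  apply: (@le_trans _ _ (flow_rate * `|Y s - Z s| ^+ 2)); last first.
    by rewrite ler_wpM2l// /flow_rate !mulr_ge0.
  apply: le_trans (ler_norm_sum _ _ _) _.
  have -> : flow_rate * `|Y s - Z s| ^+ 2 =
      d%:R * (2 * (L * `|Y s - Z s| * `|Y s - Z s|)) by rewrite /flow_rate;
        ring.
  rewrite -[d in d%:R]card_ord mulr_natl -sumr_const ler_sum// => i _.
  have -> : de i s * e i s + e i s * de i s = 2 * (de i s * e i s) by ring.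
  rewrite normrM ger0_norm//.
  rewrite ler_wpM2l// normrM ler_pM//.
    by rewrite /de coordE (le_trans (norm_coord_le _ _)).
  by rewrite /e coordE norm_coord_le.
have w0e : w 0 <= (d%:R * `|Y 0 - Z 0|) ^+ 2.
  apply: (@le_trans _ _ (d%:R * `|Y 0 - Z 0| ^+ 2)).
    rewrite -[d in d%:R]card_ord mulr_natl -sumr_const ler_sum// => i _.
    by rewrite -expr2 -real_normK ?num_real// lerXn2r ?nnegrE//
      /e coordE norm_coord_le.
  rewrite exprMn ler_wpM2r ?sqr_ge0// -natrX ler_nat.
  by case: (d) => // k; rewrite expnS expn1 leq_pmulr.
(* An exponential that is at least [1] is bounded by its square; the square root is then taken
   without halving the rate. *)
have eK : 1 <= expR (flow_rate * `|t|).
  by rewrite -expR0 ler_expR /flow_rate !mulr_ge0.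
rewrite -[leLHS]ger0_norm// -sqrtr_sqr -[leRHS]ger0_norm; last first.
  by rewrite !mulr_ge0// expR_ge0.
rewrite -sqrtr_sqr ler_wsqrtr// (le_trans (nw t))//.
apply: le_trans (gronwall wdw dwK t) _; rewrite exprMn ler_pM ?expR_ge0//.
by rewrite expr2 ler_peMl// expR_ge0.
Qed.

Lemma solution_unique Y Z : solution Y -> solution Z -> Y 0 = Z 0 -> Y =1 Z.
Proof.
move=> sY sZ YZ t; apply/eqP; rewrite -subr_eq0 -normr_le0.
by rewrite (le_trans (solution_dist sY sZ t))// YZ subrr normr0 mulr0 mul0r.
Qed.

Lemma solution_shift Y s : solution Y -> solution (fun t => Y (t + s)).
Proof.
move=> sY t; have [dY Yv] := sY (t + s).
have E : (fun h : R => h^-1 *: (((fun r => Y (r + s)) \o shift t) (h *: 1) - Y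
  (t + s))) =
    (fun h : R => h^-1 *: ((Y \o shift (t + s)) (h *: 1) - Y (t + s))).
  by apply/funext => h /=; rewrite addrA.
by apply: DeriveDef; rewrite /derivable /derive E.
Qed.

Lemma solution_translate Y c : solution Y -> (forall x, v (x + c) = v x) ->
  solution (fun t => Y t + c).
Proof.
move=> sY vc t; rewrite vc.
by have := is_deriveD (sY t) (is_derive_cst c t 1); rewrite addr0.
Qed.

End autonomous_ode.

(** * Integration on R^n *)

Section rV_integration.
Context {R : realType}.

(** The sigma-algebra is generated by the coordinates, so boxes are the sets known to be measurable.
    An open set is the union of the boxes with rational vertices that it contains, and there are
    countably many of them. *)
Lemma open_measurable_rV (n : nat) (U : set 'rV[R]_n) : open U -> measurable U.
Proof.
move=> oU; pose box (p : 'rV[rat]_n * 'rV[rat]_n) : set 'rV[R]_n :=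
  [set x | forall i, ratr (p.1 0 i) < x 0 i < ratr (p.2 0 i)].
have mbox p : measurable (box p).
  rewrite (_ : box p = \bigcap_(i in [set: 'I_n])
      (@rV_coord R n i @^-1` `]ratr (p.1 0 i), ratr (p.2 0 i)[%classic)).
    apply: fin_bigcap_measurable => // i _; rewrite -[X in measurable X]setTI.
    exact: measurable_rV_coord.
  apply/seteqP; split=> x /= h i; first by move=> _; rewrite /= in_itv /= h.
  by have := h i I; rewrite /= in_itv.
have -> : U = \bigcup_(p in [set p | box p `<=` U]) box p.
  apply/seteqP; split=> [x Ux|x [p /= pU]]; last exact: pU.
  have /nbhs_ballP[e /= e0 eU] := open_nbhs_nbhs (conj oU Ux).
  have hq i : exists q : rat * rat,
      [/\ x 0 i - e < ratr q.1, ratr q.1 < x 0 i,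
          x 0 i < ratr q.2 & ratr q.2 < x 0 i + e].
    have /rat_in_itvoo[q1] : x 0 i - e < x 0 i by rewrite ltrBlDr ltrDl.
    have /rat_in_itvoo[q2] : x 0 i < x 0 i + e by rewrite ltrDl.
    by rewrite !in_itv /= => /andP[? ?] /andP[? ?]; exists (q1, q2).
  have [q qP] := choice hq.
  exists (\row_i (q i).1, \row_i (q i).2); last first.
    by move=> i /=; rewrite !mxE; have [_ -> -> _] := qP i.
  rewrite /box /= => y yq.
  apply: eU; rewrite -ball_normE /= [ltLHS]/Num.Def.normr/= mx_normrE
    bigmax_lt//= => -[i j] _.
  rewrite !mxE /= ord1; have := yq j; rewrite !mxE => /andP[y1 y2].
  have [q1 _ _ q2] := qP j; rewrite ltr_distlC.
  by rewrite (lt_trans q1 y1) (lt_trans y2 q2).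
rewrite bigcup_mkcond.
apply: countable_bigcupT_measurable => [|p]; first exact: countableP.
by case: ifP => // _; exact: mbox.
Qed.

Lemma continuous_measurable_rV (n : nat) (f : 'rV[R]_n -> R) : continuous f ->
  measurable_fun [set: 'rV[R]_n] (f : 'rV[R]_n -> measurableTypeR R).
Proof.
move=> /continuousP cf; apply: (measurability _
  (measurable_realfun.RGenOpens.measurableE R)).
move=> _ [_ [a [b ->] <-]]; rewrite setTI; apply: open_measurable_rV.
exact/cf/interval_open.
Qed.

Definition cube (n : nat) (M : R) : set 'rV[R]_n := [set x | `|x| <= M].

Lemma measurable_cube n M : measurable (@cube n M).
Proof.
have -> : @cube n M = ~` [set x | M < `|x|].
  by apply/seteqP; split=> x /=; rewrite /cube /= leNgt; move/negP.
apply: measurableC; apply: open_measurable_rV.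
by apply: open_comp (@open_gt R M) => // x _; exact: norm_continuous.
Qed.

Lemma cube_box n M : 0 <= M ->
  @cube n M = [set x | forall i, (const_mx (- M) : 'rV[R]_n) 0 i <= x 0 i <=
    (const_mx M : 'rV[R]_n) 0 i].
Proof.
move=> M0; apply/seteqP; split=> x /= xM.
  by move=> i; rewrite !mxE -ler_norml (le_trans (norm_coord_le _ _)).
by apply: norm_le_coord => // i; have := xM i; rewrite !mxE ler_norml.
Qed.

Lemma cube_lty n M : (@rV_lebesgue R n (cube M) < +oo)%E.
Proof.
have [M0|M0] := leP 0 M.
  rewrite cube_box// rV_lebesgue_box ?ltry// => i.
  by rewrite !mxE (le_trans _ M0)// oppr_le0.
rewrite (_ : cube M = set0) ?measure0//.
by apply/seteqP; split=> // x; rewrite /cube /= leNgt (lt_le_trans M0).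
Qed.

(** Compact support with an explicit radius, which can be followed through compositions with maps of
    bounded displacement and makes integral bounds uniform over families of functions. *)
Definition supported_in (n : nat) (M : R) (f : 'rV[R]_n -> R) :=
  forall x, M < `|x| -> f x = 0.

Lemma supported_patch n M (f : 'rV[R]_n -> R) : supported_in M f ->
  EFin \o f = (EFin \o f) \_ (cube M).
Proof.
move=> fM; apply/funext => x /=; rewrite patchE; case: ifPn => //.
rewrite notin_setE /cube /= => /negP; rewrite -real_ltNge ?num_real// =>
  /fM ->//.
Qed.

Lemma bounded_supported_integrable n M K (f : 'rV[R]_n -> R) :
  measurable_fun [set: 'rV[R]_n] (f : 'rV[R]_n -> measurableTypeR R) ->
  supported_in M f -> (forall x, `|f x| <= K) ->
  (@rV_lebesgue R n).-integrable [set: 'rV[R]_n] (EFin \o f).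
Proof.
move=> mf fM fK; rewrite (supported_patch fM).
apply/(integrable_mkcond _ (measurable_cube _)).
apply: measurable_bounded_integrable.
- exact: measurable_cube.
- exact: cube_lty.
- exact: measurable_funTS.
- exists K; split; first exact: num_real.
  by move=> r Kr x _ /=; exact: le_trans (fK x) (ltW Kr).
Qed.

Lemma continuous_supported_bounded n M (f : 'rV[R]_n -> R) : continuous f ->
  supported_in M f -> exists2 K, 0 <= K & forall x, `|f x| <= K.
Proof.
move=> cf fM; have cM : compact (@cube n M).
  apply: bounded_closed_compact.
    exists M; split; first exact: num_real.
    by move=> r Mr x xM; exact: le_trans xM (ltW Mr).
  by apply: closed_comp (@closed_le R M) => // x _; exact: norm_continuous.
have [K [_ KQ]] := compact_bounded (continuous_compact (continuous_subspaceT
  cf) cM).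
have K1 : K < `|K| + 1 by rewrite (le_lt_trans (ler_norm K))// ltrDl.
exists (`|K| + 1); first by rewrite addr_ge0.
move=> x; have [xM|Mx] := leP `|x| M; first by apply: (KQ _ K1); exists x.
by rewrite fM// normr0 addr_ge0.
Qed.

Lemma continuous_supported_integrable n M (f : 'rV[R]_n -> R) : continuous f ->
  supported_in M f -> (@rV_lebesgue R n).-integrable [set: 'rV[R]_n] (EFin \o
    f).
Proof.
move=> cf fM; have [K _ fK] := continuous_supported_bounded cf fM.
by apply: bounded_supported_integrable fM fK; exact: continuous_measurable_rV.
Qed.

Lemma supported_integral_bound n M K (f : 'rV[R]_n -> R) :
  continuous f -> supported_in M f -> (forall x, `|f x| <= K) ->
  `|\int[@rV_lebesgue R n]_x f x| <= K * fine (@rV_lebesgue R n (cube M)).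
Proof.
move=> cf fM fK.
have fi := continuous_supported_integrable cf fM.
have -> : \int[@rV_lebesgue R n]_x f x = \int[@rV_lebesgue R n]_(x in cube M) f
  x.
  by rewrite /Rintegral [in RHS]integral_mkcond -(supported_patch fM).
have fiM : (@rV_lebesgue R n).-integrable (cube M) (EFin \o f).
  by apply: integrableS fi => //; exact: measurable_cube.
have mM := @measurable_cube n M.
rewrite (le_trans (le_normr_Rintegral _ fiM))// -Rintegral_cst//.
apply: le_Rintegral => //.
  by have := integrable_norm fiM.
apply: measurable_bounded_integrable => //.
- exact: cube_lty.
- exists `|K|; split; first exact: num_real.
  by move=> r Kr x _ /=; exact: ltW.
Qed.

End rV_integration.

(** * Integrals that vanish along every line parallel to an axis *)

Section integrals_along_coordinates.
Context {R : realType}.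

Lemma integral_derivative_eq0 (f Q : R -> R) (T : R) : continuous f ->
  (forall t, is_derive t (1 : R) Q (f t)) ->
  (forall t, T < `|t| -> f t = 0) -> (forall t, T < `|t| -> Q t = 0) ->
  (\int[@lebesgue_measure R]_t (f t)%:E = 0)%E.
Proof.
move=> cf Qf fT QT; pose N := `|T| + 1.
have TN : T < N by rewrite (le_lt_trans (ler_norm T))// ltrDl.
have N0 : 0 < N by rewrite ltr_wpDl.
have NN : - N < N by rewrite (@lt_trans _ _ 0)// oppr_lt0.
have -> : (\int[@lebesgue_measure R]_t (f t)%:E =
    \int[@lebesgue_measure R]_(t in `[(- N)%R, N]) (f t)%:E)%E.
  rewrite [in RHS]integral_mkcond; apply: eq_integral => t _.
  rewrite patchE; case: ifPn => //; rewrite notin_setE /= in_itv /= => /negP.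
  by rewrite -ler_norml -ltNge => /(lt_trans TN)/fT ->.
rewrite (@continuous_FTC2 _ f Q)//.
- by rewrite !QT ?normrN ?ger0_norm ?(ltW N0)// sube0.
- exact/continuous_subspaceT.
- have cQ := is_derive_continuous Qf.
  split; [by move=> t _; have [] := Qf t|exact/cvg_at_right_filter/cQ|
    exact/cvg_at_left_filter/cQ].
- by move=> t _; have := Qf t => ?; rewrite derive1E derive_val.
Qed.

(** The measure in dimension [n.+1] is by construction the pushforward of a product measure under
    [rV_cons]; this makes Fubini's theorem applicable. *)
Lemma integral_rV_cons (n : nat) (f : 'rV[R]_n.+1 -> R) :
  measurable_fun [set: 'rV[R]_n.+1] (f : _ -> measurableTypeR R) ->
  (@rV_lebesgue R n.+1).-integrable [set: 'rV[R]_n.+1] (EFin \o f) ->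
  (lebesgue_measure \x @rV_lebesgue R n)%E.-integrable [set: _]
    (fun p => (f (rV_cons p))%:E) /\
  (\int[@rV_lebesgue R n.+1]_x (f x)%:E =
   \int[lebesgue_measure \x @rV_lebesgue R n]_p (f (rV_cons p))%:E)%E.
Proof.
move=> mf fi.
have mcons := @measurable_rV_cons R n.
have mabs := measurable_int _ (integrable_abse fi).
have fi' : (lebesgue_measure \x @rV_lebesgue R n)%E.-integrable [set: _]
    (fun p => (f (rV_cons p))%:E).
  apply/integrableP; split.
    by apply/measurable_realfun.measurable_EFinP;
      exact: measurableT_comp mf mcons.
  move/integrableP : fi => [_].
  rewrite (_ : (\int[_]_x _)%E = \int[pushforward (lebesgue_measure \x
    @rV_lebesgue R n)%E
     (@rV_cons R n)]_x `|(EFin \o f) x|)%E //.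
  by rewrite ge0_integral_pushforward ?preimage_setT.
split=> //.
rewrite (_ : (\int[@rV_lebesgue R n.+1]_x _)%E =
  \int[pushforward (lebesgue_measure \x @rV_lebesgue R n)%E
     (@rV_cons R n)]_x (EFin \o f) x)%E //.
rewrite integral_pushforward ?preimage_setT//.
exact/measurable_realfun.measurable_EFinP.
Qed.

Lemma rV_cons_0 (n : nat) (p : measurableTypeR R * 'rV[R]_n)
  : rV_cons p 0 0 = p.1 :> R.
Proof. by have /(congr1 fst) := @rV_consK R n p. Qed.

Lemma rV_cons_lift (n : nat) (p : measurableTypeR R * 'rV[R]_n) (i : 'I_n)
  : rV_cons p 0 (lift ord0 i) = p.2 0 i :> R.
Proof.
have /(congr1 snd)/= <- := rV_consK p.
by rewrite [RHS]mxE; congr (_ _ _); apply/val_inj.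
Qed.

Lemma rV_cons_slice0 (n : nat) (t : R) (x : 'rV[R]_n) :
  rV_cons (t, x) = rV_cons (0, x) + t *: 'e_0 :> 'rV[R]_n.+1.
Proof.
apply/rowP => i; rewrite [RHS]mxE [X in _ = _ + X]mxE [X in _ = _ + _ * X]mxE.
case: (unliftP ord0 i) => [j|] -> /=.
  by rewrite !rV_cons_lift mulr0 addr0.
by rewrite !rV_cons_0 mulr1 add0r.
Qed.

Lemma rV_cons_slice (n : nat) (s t : R) (x : 'rV[R]_n) (i : 'I_n) :
  rV_cons (s, x + t *: 'e_i) = rV_cons (s, x) + t *: 'e_(lift ord0 i) :>
    'rV[R]_n.+1.
Proof.
apply/rowP => k; rewrite [RHS]mxE [X in _ = _ + X]mxE [X in _ = _ + _ * X]mxE.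
case: (unliftP ord0 k) => [j|] -> /=; last by rewrite !rV_cons_0 mulr0 addr0.
by rewrite !rV_cons_lift /= !mxE /= (inj_eq lift_inj).
Qed.

Lemma rV_cons_continuous (n : nat) (t : R) :
  continuous (fun x : 'rV[R]_n => rV_cons (t, x) : 'rV[R]_n.+1).
Proof.
apply: (@lipschitz_continuous _ _ _ _ 1) => x y; rewrite mul1r.
apply: norm_le_coord => // i; rewrite mxE [X in _ + X]mxE.
case: (unliftP ord0 i) => [j|] ->; last by rewrite !rV_cons_0 subrr normr0.
by rewrite !rV_cons_lift; have := norm_coord_le (x - y) j; rewrite !mxE.
Qed.

Lemma norm_rV_cons (n : nat) (t : R) (x : 'rV[R]_n) :
  `|x| <= `|rV_cons (t, x) : 'rV[R]_n.+1|.
Proof.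
apply: norm_le_coord => // i.
by rewrite -[x in leLHS]/(t, x).2 -rV_cons_lift norm_coord_le.
Qed.

(** Fubini's theorem, by induction on the dimension. The product splits off coordinate [0] only: if
    [i] is that coordinate, it is integrated innermost; otherwise the induction hypothesis applies
    to each slice where coordinate [0] is fixed. *)
Lemma integral_eq0_along_coordinate (n : nat) (i : 'I_n) (M : R)
    (f : 'rV[R]_n -> R) : continuous f -> supported_in M f ->
  (forall x, (\int[@lebesgue_measure R]_t (f (x + t *: 'e_i))%:E = 0)%E) ->
  (\int[@rV_lebesgue R n]_x (f x)%:E = 0)%E.
Proof.
elim: n i f => [[]//|n IH] i f cf fM f0.
have [fi ->] := integral_rV_cons (continuous_measurable_rV cf)
  (continuous_supported_integrable cf fM).
case: (unliftP ord0 i) => [j|] iE; rewrite {}iE in f0.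
  rewrite -(integral12_prod_meas1 fi); apply: integral0_eq => t _.
  rewrite /fubini_F; apply: (IH j (fun x => f (rV_cons (t, x)))).
  - by move=> x; apply: continuous_comp; [exact: rV_cons_continuous|exact: cf].
  - by move=> x Mx; rewrite fM// (lt_le_trans Mx)// norm_rV_cons.
  - by move=> x; under eq_integral => s _ do rewrite rV_cons_slice; exact: f0.
rewrite -(integral21_prod_meas1 fi); apply: integral0_eq => x _.
by rewrite /fubini_G; under eq_integral => t _ do rewrite rV_cons_slice0;
  exact: f0.
Qed.

End integrals_along_coordinates.

(** * Linearity of the integral on continuous functions with bounded support *)

Section integral_linearity.
Context {R : realType} {n : nat}.
Implicit Types (f g : 'rV[R]_n -> R) (M : R).

Lemma supported_le M M' f : M <= M' -> supported_in M f -> supported_in M' f.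
Proof. by move=> MM' fM x /(le_lt_trans MM')/fM. Qed.

Lemma integral_supportedB M M' f g : continuous f -> continuous g ->
  supported_in M f -> supported_in M' g ->
  \int[@rV_lebesgue R n]_x (f x - g x) =
  \int[@rV_lebesgue R n]_x f x - \int[@rV_lebesgue R n]_x g x.
Proof.
move=> cf cg fM gM.
by apply: RintegralB => //; [exact: continuous_supported_integrable fM|
  exact: continuous_supported_integrable gM].
Qed.

Lemma integral_supportedD M M' f g : continuous f -> continuous g ->
  supported_in M f -> supported_in M' g ->
  \int[@rV_lebesgue R n]_x (f x + g x) =
  \int[@rV_lebesgue R n]_x f x + \int[@rV_lebesgue R n]_x g x.
Proof.
move=> cf cg fM gM.
by apply: RintegralD => //; [exact: continuous_supported_integrable fM|
  exact: continuous_supported_integrable gM].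
Qed.

Lemma integral_supportedZ M f (c : R) : continuous f -> supported_in M f ->
  \int[@rV_lebesgue R n]_x (c * f x) = c * \int[@rV_lebesgue R n]_x f x.
Proof.
by move=> cf fM; apply: RintegralZl => //; exact:
  continuous_supported_integrable fM.
Qed.

End integral_linearity.

(** * Lipschitz functions displaced along a vector field *)

Section shears.
Context {R : realType} {d : nat} (v : 'rV[R]_d -> 'rV[R]_d)
  (w : 'I_d -> 'rV[R]_d -> R) (L K : R).
Hypotheses (L0 : 0 <= L) (K0 : 0 <= K).
Hypothesis vL : forall x y, `|v x - v y| <= L * `|x - y|.
Hypothesis vK : forall x, `|v x| <= K.
Hypothesis wK : forall i x, `|w i x| <= K.
Hypothesis wc : forall i, continuous (w i).
Hypothesis vw : forall i x (t : R),
  is_derive t (1 : R) (fun s : R => v (x + s *: 'e_i) 0 i) (w i (x + t *: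
    'e_i)).

Definition lip (C : R) (f : 'rV[R]_d -> R) :=
  forall x y, `|f x - f y| <= C * `|x - y|.

Definition shear (h : R) (i : 'I_d) (x : 'rV[R]_d) : 'rV[R]_d :=
  x + (h * v x 0 i) *: 'e_i.

Lemma norm_unit_le (i : 'I_d) : `|('e_i : 'rV[R]_d)| <= 1.
Proof.
by apply: norm_le_coord => // j; rewrite !mxE /=; case: eqP;
  rewrite ?normr1 ?normr0.
Qed.

Lemma vcoord_le i x : `|v x 0 i| <= K.
Proof. exact: le_trans (norm_coord_le _ _) (vK x). Qed.

Lemma vcoord_lip i : lip L (fun x => v x 0 i).
Proof.
move=> x y; rewrite (_ : _ - _ = (v x - v y) 0 i); last by rewrite !mxE.
exact: le_trans (norm_coord_le _ _) (vL x y).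
Qed.

Lemma shear_near h i x : `|h| <= 1 -> `|shear h i x - x| <= K * `|h|.
Proof.
move=> h1; rewrite /shear addrC addKr normrZ normrM [leRHS]mulrC.
by rewrite -[leRHS]mulr1 !ler_pM ?mulr_ge0 ?vcoord_le ?norm_unit_le.
Qed.

Lemma shear_lip h i x y : `|h| <= 1 ->
  `|shear h i x - shear h i y| <= (1 + L) * `|x - y|.
Proof.
move=> h1; rewrite /shear opprD addrACA -scalerBl -mulrBr mulrDl mul1r.
rewrite (le_trans (ler_normD _ _))// lerD2l normrZ -[leRHS]mulr1.
rewrite ler_pM ?norm_unit_le// normrM -[leRHS]mul1r ler_pM//; exact: vcoord_lip.
Qed.

Lemma lip_comp_shear C h i f : 0 <= C -> `|h| <= 1 -> lip C f ->
  lip (C * (1 + L)) (f \o shear h i).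
Proof.
move=> C0 h1 fC x y; rewrite (le_trans (fC _ _))// -mulrA ler_wpM2l//.
exact: shear_lip.
Qed.

Lemma supported_comp_near (p : 'rV[R]_d -> 'rV[R]_d) (D M : R) (f : 'rV[R]_d ->
  R) :
  (forall x, `|p x - x| <= D) -> supported_in M f ->
    supported_in (M + D) (f \o p).
Proof.
move=> pD fM x Mx; apply: fM; rewrite -(ltrD2r D) (lt_le_trans Mx)//.
rewrite -[x in leLHS](subKr (p x)) (le_trans (ler_normB _ _))// lerD2l.
exact: pD.
Qed.

Lemma supported_comp_shear h i M f : `|h| <= 1 -> supported_in M f ->
  supported_in (M + K) (f \o shear h i).
Proof.
move=> h1; apply: supported_comp_near => x; rewrite (le_trans (shear_near _ _
  h1))//.
by rewrite -[leRHS]mulr1 ler_wpM2l.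
Qed.

Lemma lip_continuous C f : lip C f -> continuous f.
Proof. exact: lipschitz_continuous. Qed.

Lemma shear_continuous h i : `|h| <= 1 -> continuous (shear h i).
Proof. by move=> h1; apply: lipschitz_continuous => x y; exact: shear_lip. Qed.

(** The endpoints are unordered because a shear may move a point either way along its axis. *)
Lemma derive_eq0_within (P g : R -> R) (a b : R) :
  (forall t, is_derive t (1 : R) P (g t)) ->
  (forall t, Num.min a b <= t <= Num.max a b -> g t = 0) -> P a = P b.
Proof.
move=> Pg; wlog ab : a b / a <= b => [H|].
  have /orP[|ab] := le_total a b; first exact: H.
  by rewrite minC maxC => g0; rewrite (H b a).
rewrite (min_idPl ab) (max_idPr ab) => g0; apply/esym/eqP.
rewrite -subr_eq0 -normr_le0.
have := @derive_bound R P g 0 a b ab (fun t _ => Pg t).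
by rewrite mul0r; apply => t /g0 ->; rewrite normr0.
Qed.

Lemma norm_line_ge (x : 'rV[R]_d) i (t : R) : `|t| - `|x| <= `|x + t *: 'e_i|.
Proof.
rewrite lerBlDr; have /le_trans-> //: `|t| <= `|t *: 'e_i : 'rV[R]_d|.
  by have := norm_coord_le (t *: 'e_i : 'rV[R]_d) i; rewrite !mxE !eqxx mulr1.
by rewrite -{1}(addKr x (t *: 'e_i)) [- x + _]addrC ler_normB.
Qed.

(* On each line parallel to ['e_i], [(P \o p)^`() = (G \o p) * p^`()] for an
   antiderivative [P] of [G]: no monotonicity of the substitution [p] is used.
     *)
Lemma integral_shear h i M (G : 'rV[R]_d -> R) : `|h| <= 1 -> continuous G ->
  supported_in M G ->
  \int[@rV_lebesgue R d]_x (G (shear h i x) * (1 + h * w i x)) =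
  \int[@rV_lebesgue R d]_x G x.
Proof.
move=> h1 cG GM; pose F x := G (shear h i x) * (1 + h * w i x) - G x.
have cGs : continuous (fun x => G (shear h i x) * (1 + h * w i x)).
  have cs : continuous (shear h i) by exact: shear_continuous.
  apply: continuous_mul; first exact: (continuous_fun_comp cs cG).
  by apply: continuous_add; [|apply: continuous_mul];
    try exact: continuous_cst; exact: wc.
have sGs : supported_in (M + K) (fun x => G (shear h i x) * (1 + h * w i x)).
  by move=> x /(supported_comp_shear i h1 GM) /= ->; rewrite mul0r.
have cF : continuous F by exact: continuous_sub.
have sF : supported_in (M + K) F.
  move=> x Mx; rewrite /F (sGs _ Mx) GM ?subr0//.
  by rewrite (le_lt_trans _ Mx)// lerDl.
apply/eqP; rewrite -subr_eq0 -(integral_supportedB cGs cG sGs GM).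
rewrite /Rintegral (integral_eq0_along_coordinate cF sF (i := i)) // => x.
pose g s := G (x + s *: 'e_i); pose P s := oriented_integral 0 s g.
pose p s := s + h * v (x + s *: 'e_i) 0 i.
have cl : continuous (fun s : R => x + s *: 'e_i : 'rV[R]_d).
  exact: is_derive_continuous (is_derive_line x 'e_i).
have cg : continuous g.
  exact: continuous_fun_comp cl cG.
have Pg (s : R) : is_derive s (1 : R) P (g s)
  by exact: is_derive_oriented_integral.
have pE (s : R) : is_derive s (1 : R) p (1 + h * w i (x + s *: 'e_i)).
  exact: is_deriveD.
(* [Q s] is the integral of [g] from [s] to [p s], and an antiderivative of [F] along the line. *)
pose Q s := P (p s) - P s.
have FE s : F (x + s *: 'e_i) = g (p s) * (1 + h * w i (x + s *: 'e_i)) - g s.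
  by rewrite /F /shear -addrA -scalerDl.
have QF (s : R) : is_derive s (1 : R) Q (F (x + s *: 'e_i)).
  rewrite FE; exact: is_deriveB.
have cFx : continuous (fun s : R => F (x + s *: 'e_i)).
  exact: continuous_fun_comp cl cF.
have ps s : `|p s - s| <= K.
  rewrite /p addrC addKr normrM -[leRHS]mul1r ler_pM//; exact: vcoord_le.
(* The interval between [s] and [p s] has length at most [K]. For [|s| > M + K + |x|] the
   corresponding points of the line all have norm greater than [M], where [G] vanishes, so
   [Q s = 0]. *)
apply: (integral_derivative_eq0 (T := M + K + `|x|) cFx QF) => s sT.
  by apply: sF; rewrite (lt_le_trans _ (norm_line_ge _ _ _))// ltrBrDr.
apply/eqP; rewrite subr_eq0; apply/eqP; apply: (derive_eq0_within Pg) => t st.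
apply: GM; rewrite (lt_le_trans _ (norm_line_ge _ _ _))// ltrBrDr.
have : `|t - s| <= K.
  have := ps s; rewrite !ler_norml; move: st; rewrite ge_min le_max.
  by move=> /andP[/orP[] ? /orP[] ?] /andP[? ?]; apply/andP; split; lra.
have := ler_distD t s 0; rewrite !subr0 distrC => + ?.
by move: sT => *; lra.
Qed.

Lemma supported_mulr M (f g : 'rV[R]_d -> R) : supported_in M f ->
  supported_in M (fun x => f x * g x).
Proof. by move=> fM x Mx; rewrite fM// mul0r. Qed.

Lemma sqr_normr_mul (h : R) : h ^+ 2 = `|h| * `|h|.
Proof. by rewrite -normrM -expr2 ger0_norm ?sqr_ge0. Qed.

(** By the exact change of variables the quantity equals [h] times the integral of
    [(G - G \o shear h i) * w i]. The difference is at most [C * K * |h|] and [w i] at most [K], on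
    a cube of radius [M + K]; hence [D], which depends on [G] only through [C] and [M]. *)
Lemma integral_comp_shear (C M : R) : 0 <= C -> exists D,
  forall h i G, `|h| <= 1 -> lip C G -> supported_in M G ->
  `|\int[@rV_lebesgue R d]_x (G (shear h i x)) - \int[@rV_lebesgue R d]_x G x
    + h * \int[@rV_lebesgue R d]_x (G x * w i x)| <= D * h ^+ 2.
Proof.
move=> C0; exists (C * K * K * fine (@rV_lebesgue R d (cube (M + K)))) =>
  h i G h1 GC GM.
have cG := lip_continuous GC.
have cs : continuous (shear h i) by exact: shear_continuous.
have cGs := continuous_fun_comp cs cG.
have GsM := supported_comp_shear i h1 GM.
have cGsw := continuous_mul cGs (@wc i).
have cGw := continuous_mul cG (@wc i).
have GM' : supported_in (M + K) G by apply: supported_le GM; rewrite lerDl.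
rewrite -{1}(integral_shear i h1 cG GM).
have -> : (fun x => G (shear h i x) * (1 + h * w i x)) =
    (fun x => G (shear h i x) + h * (G (shear h i x) * w i x)).
  by apply/funext => x; ring.
have GswM : supported_in (M + K) (fun x => h * (G (shear h i x) * w i x)).
  by move=> x /(supported_mulr (w i) GsM) /= ->; rewrite mulr0.
rewrite (integral_supportedD cGs (continuous_mul (@continuous_cst _ _ h) cGsw)
  GsM GswM).
rewrite (integral_supportedZ h cGsw (supported_mulr (w i) GsM)).
rewrite opprD addrA subrr add0r addrC -mulrBr.
rewrite -(integral_supportedB cGw cGsw (supported_mulr _ GM') (supported_mulr _
  GsM)).
rewrite normrM.
have -> : C * K * K * fine (@rV_lebesgue R d (cube (M + K))) * h ^+ 2 =
    `|h| * (C * K * K * `|h| * fine (@rV_lebesgue R d (cube (M + K)))).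
  by rewrite sqr_normr_mul; ring.
rewrite ler_wpM2l//; apply: supported_integral_bound.
- exact: continuous_sub.
- by move=> x Mx; rewrite (supported_mulr _ GM' Mx) (supported_mulr _ GsM Mx)
  subr0.
- move=> x; rewrite -mulrBl normrM mulrAC ler_pM//.
  rewrite (le_trans (GC _ _))// -mulrA ler_wpM2l// distrC; exact: shear_near.
Qed.

Definition shears (h : R) (l : seq 'I_d) (x : 'rV[R]_d) := foldr (shear h) x l.

(** Each new shear evaluates [v] at the already displaced point [y] instead of [x]. As [y - x] is of
    order [h] and [v] is Lipschitz, the extra factor [h] of the shear makes this discrepancy of
    order [h^2]. *)
Lemma shears_expansion (l : seq 'I_d) : exists2 D, 0 <= D &
  forall h x, `|h| <= 1 ->
  `|shears h l x - (x + h *: \sum_(i <- l) v x 0 i *: 'e_i)| <= D * h ^+ 2.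
Proof.
elim: l => [|i l [D D0 IH]].
  by exists 0 => // h x _; rewrite big_nil scaler0 addr0 subrr normr0 mul0r.
exists (D + L * (D + (size l)%:R * K)); first
  by rewrite addr_ge0 ?mulr_ge0 ?addr_ge0 ?mulr_ge0.
move=> h x h1; rewrite big_cons /=; set y := shears h l x; set p :=
  \sum_(j <- l) _.
have hh := sqr_normr_mul h.
have hh1 : h ^+ 2 <= `|h| by rewrite hh -[leRHS]mul1r ler_wpM2r.
have pK : `|p| <= (size l)%:R * K.
  rewrite /p; elim: (l) => [|j k IHk]; first by rewrite big_nil normr0 mul0r.
  rewrite big_cons (le_trans (ler_normD _ _))//= mulrSr mulrDl mul1r addrC
    lerD//.
  by rewrite normrZ -[leRHS]mulr1 ler_pM// ?vcoord_le ?norm_unit_le.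
have yx : `|y - x| <= (D + (size l)%:R * K) * `|h|.
  have -> : y - x = (y - (x + h *: p)) + h *: p by rewrite opprD addrA subrK.
  rewrite (le_trans (ler_normD _ _))// mulrDl lerD//.
    by rewrite (le_trans (IH h x h1))// ler_wpM2l.
  by rewrite normrZ mulrC ler_wpM2r.
rewrite /shear.
have -> : y + (h * v y 0 i) *: 'e_i - (x + h *: (v x 0 i *: 'e_i + p)) =
    (y - (x + h *: p)) + (h * (v y 0 i - v x 0 i)) *: 'e_i.
  rewrite scalerDr scalerA mulrBr scalerBl !opprD !addrA.
  by rewrite -!addrA; congr (y + _); rewrite addrCA; congr (- x + _);
    rewrite addrA addrC.
rewrite (le_trans (ler_normD _ _))// mulrDl lerD//; first exact: IH.
have -> : L * (D + (size l)%:R * K) * h ^+ 2 =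
    `|h| * (L * ((D + (size l)%:R * K) * `|h|)) by rewrite hh; ring.
rewrite normrZ normrM -[leRHS]mulr1 ler_pM ?mulr_ge0 ?norm_unit_le//
  ler_wpM2l//.
by rewrite (le_trans (vcoord_lip _ _ _))// ler_wpM2l.
Qed.

(** The induction hypothesis is applied to [G \o shear h i], whose Lipschitz constant is
    [C * (1 + L)] and whose support radius is [M + K]. The errors are [D2] from the remaining
    shears, [D1] from the outer one, and [D3] from replacing [G \o shear h i] by [G] in the
    first-order term. *)
Lemma integral_comp_shears (l : seq 'I_d) (C M : R) : 0 <= C -> exists D,
  forall h G, `|h| <= 1 -> lip C G -> supported_in M G ->
  [/\ continuous (G \o shears h l),
      supported_in (M + (size l)%:R * K) (G \o shears h l) &
  `|\int[@rV_lebesgue R d]_x (G (shears h l x)) - \int[@rV_lebesgue R d]_x G x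
    + h * \int[@rV_lebesgue R d]_x (G x * \sum_(i <- l) w i x)| <= D * h ^+ 2].
Proof.
elim: l C M => [|i l IH] C M C0.
  exists 0 => h G h1 GC GM; rewrite mul0r addr0; split => //.
    exact: lip_continuous GC.
  under [X in _ * X]eq_Rintegral => x _ do rewrite big_nil mulr0.
  by rewrite Rintegral_cst// mul0r mulr0 addr0 subrr normr0 mul0r.
have [D1 D1P] := integral_comp_shear M C0.
have C'0 : 0 <= C * (1 + L) by rewrite mulr_ge0// addr_ge0.
have [D2 D2P] := IH _ (M + K) C'0.
pose W x := \sum_(j <- l) w j x.
have cW : continuous W by exact: continuous_sum.
have WK x : `|W x| <= (size l)%:R * K.
  rewrite /W; elim: (l) => [|j k IHk]; first by rewrite big_nil normr0 mul0r.
  rewrite big_cons (le_trans (ler_normD _ _))//= mulrSr mulrDl mul1r addrC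
    lerD//.
pose D3 := C * K * ((size l)%:R * K) * fine (@rV_lebesgue R d (cube (M + K))).
exists (D2 + D1 + D3) => h G h1 GC GM.
have cG := lip_continuous GC.
have G'C := lip_comp_shear i C0 h1 GC.
have G'M := supported_comp_shear i h1 GM.
have cG' := lip_continuous G'C.
have GM' : supported_in (M + K) G by apply: supported_le GM; rewrite lerDl.
have [cGl sGl D2h] := D2P h _ h1 G'C G'M.
split.
- exact: cGl.
- rewrite (_ : M + _ = M + K + (size l)%:R * K) //.
  by rewrite /= mulrSr mulrDl mul1r addrA addrAC.
have D1h := D1P h i G h1 GC GM.
have cGW := continuous_mul cG cW.
have cG'W := continuous_mul cG' cW.
have -> : (fun x => G x * \sum_(j <- i :: l) w j x) = (fun x =>
  G x * w i x + G x * W x).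
  by apply/funext => x; rewrite big_cons mulrDr.
rewrite (integral_supportedD (continuous_mul cG (@wc i)) cGW (supported_mulr _
  GM) (supported_mulr _ GM)).
have D3h : `|h * \int[@rV_lebesgue R d]_x (G x * W x - (G \o shear h i) x * W
  x)| <= D3 * h ^+ 2.
  rewrite normrM sqr_normr_mul.
  have -> : D3 * (`|h| * `|h|) = `|h| * (C * K * `|h| * ((size l)%:R * K) *
    fine (@rV_lebesgue R d (cube (M + K)))) by rewrite /D3; ring.
  rewrite ler_wpM2l//; apply: supported_integral_bound.
  - exact: continuous_sub.
  - by move=> x Mx; rewrite (supported_mulr _ GM' Mx) (supported_mulr _ G'M Mx)
    subr0.
  - move=> x; rewrite -mulrBl normrM ler_pM//.
    rewrite (le_trans (GC _ _))// -mulrA ler_wpM2l// distrC; exact: shear_near.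
rewrite (integral_supportedB cGW cG'W (supported_mulr _ GM) (supported_mulr _
  G'M)) in D3h.
rewrite !mulrDl.
have := lerD (lerD D2h D1h) D3h; apply: le_trans.
apply: le_trans; last by apply: lerD; [exact: ler_normD|exact: lexx].
apply: le_trans; last exact: ler_normD.
rewrite /comp /= le_eqVlt; apply/orP; left; apply/eqP; congr (`|_|); ring.
Qed.

(* The divergence theorem at first order in [h], for [G] merely Lipschitz: up to
   [O(h^2)] the map [x + h *: v x] is a composition of shears. *)
Lemma integral_euler_step (C M : R) : 0 <= C -> exists D,
  forall h G, `|h| <= 1 -> lip C G -> supported_in M G ->
  `|\int[@rV_lebesgue R d]_x G (x + h *: v x) - \int[@rV_lebesgue R d]_x G x
    + h * \int[@rV_lebesgue R d]_x (G x * \sum_i w i x)| <= D * h ^+ 2.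
Proof.
move=> C0; have [D1 D1P] := integral_comp_shears (index_enum 'I_d) M C0.
have [D2 D20 D2P] := shears_expansion (index_enum 'I_d).
pose N := Num.max (M + (size (index_enum 'I_d))%:R * K) (M + K).
exists (D1 + C * D2 * fine (@rV_lebesgue R d (cube N))) => h G h1 GC GM.
have cG := lip_continuous GC.
have [cGs sGs D1h] := D1P h G h1 GC GM.
have cv : continuous (fun x : 'rV[R]_d => x + h *: v x).
  apply: (@lipschitz_continuous R _ _ _ (1 + `|h| * L)) => x y.
  rewrite opprD addrACA -scalerBr (le_trans (ler_normD _ _))//
    mulrDl mul1r lerD2l.
  by rewrite normrZ -mulrA ler_wpM2l.
have cGv := continuous_fun_comp cv cG.
have sGv : supported_in (M + K) (fun x => G (x + h *: v x)).
  apply: supported_comp_near GM => x; rewrite addrC addKr normrZ.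
  by rewrite -[leRHS]mul1r ler_pM.
have vE x : \sum_i v x 0 i *: 'e_i = v x by rewrite [in RHS](row_sum_delta (v
  x)).
have close : `|\int[@rV_lebesgue R d]_x (G (x + h *: v x) - G (shears h
  (index_enum 'I_d) x))| <=
    C * D2 * h ^+ 2 * fine (@rV_lebesgue R d (cube N)).
  apply: supported_integral_bound.
  - exact: continuous_sub.
  - move=> x; rewrite gt_max => /andP[N1 N2].
    by rewrite (sGv _ N2); have /= -> := sGs _ N1; rewrite subr0.
  - move=> x; rewrite (le_trans (GC _ _))// -mulrA ler_wpM2l// distrC.
    by have := D2P h x h1; rewrite vE.
rewrite (integral_supportedB cGv cGs sGv sGs) in close.
rewrite mulrDl (mulrAC (C * D2)).
have := lerD D1h close; apply: le_trans; apply: le_trans (ler_normD _ _).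
by rewrite le_eqVlt; apply/orP; left; apply/eqP; congr (`|_|); rewrite /comp;
  ring.
Qed.

End shears.

(** * Uniform bounds from periodicity and regularity *)

Section regularity.
Context {R : realType} {d : nat}.
Implicit Types (f u : 'rV[R]_d -> R).

Lemma uniform_bound (I : finType) (T : Type) (f : I -> T -> R) :
  (forall i, exists K, forall x, `|f i x| <= K) ->
  exists2 K, 0 <= K & forall i x, `|f i x| <= K.
Proof.
move=> /choice[b fb]; exists (\sum_i `|b i|); first exact: sumr_ge0.
move=> i x; rewrite (le_trans (fb i x))// (le_trans (ler_norm _))//.
by rewrite (bigD1 i)//= lerDl sumr_ge0.
Qed.

Lemma norm_sum_le (F : 'I_d -> R) (K : R) : (forall i, `|F i| <= K) ->
  `|\sum_i F i| <= d%:R * K.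
Proof.
move=> FK; rewrite (le_trans (ler_norm_sum _ _ _))// -[X in X%:R]card_ord.
by rewrite mulr_natl -sumr_const ler_sum.
Qed.

Lemma CkS_continuous k f : Ck k.+1 f -> continuous f.
Proof. by move=> [df _] x; exact: differentiable_continuous. Qed.

Lemma is_derive_partial f x i (t : R) : (forall y, differentiable f y) ->
  is_derive t (1 : R) (fun s : R => f (x + s *: 'e_i)) (partial i f (x + t *:
    'e_i)).
Proof.
move=> df; have := is_derive_along (df _) (is_derive_line x 'e_i t).
move/is_derive_eq; apply; rewrite /dotp (bigD1 i)//= big1 ?addr0.
  by rewrite !mxE !eqxx mulr1.
by move=> j ji; rewrite !mxE eqxx (negbTE ji) mulr0.
Qed.

Lemma partial_grad_periodic (B : 'M[R]_d) u i :
  Y_periodic B (grad u) -> Y_periodic B (partial i u).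
Proof. by move=> pu x j; have /rowP/(_ i) := pu x j; rewrite !mxE. Qed.

Lemma laplacian_periodic (B : 'M[R]_d) u :
  Y_periodic B (grad u) -> Y_periodic B (laplacian u).
Proof.
move=> pu x j; apply: eq_bigr => i _; apply: partial_periodic.
exact: partial_grad_periodic.
Qed.

(** All partial derivatives of [u] of orders one to three are continuous and periodic, hence
    bounded. The third order is what makes the Laplacian Lipschitz. A single constant is kept for
    all five bounds. *)
Lemma periodic_C3_bounds (B : 'M[R]_d) u : B \in unitmx -> Ck 3 u ->
  Y_periodic B (grad u) -> exists2 C, 0 <= C &
  [/\ forall x, `|grad u x| <= C,
      forall x y, `|grad u x - grad u y| <= C * `|x - y|,
      forall i x, `|partial i (partial i u) x| <= C,
      forall x, `|laplacian u x| <= C &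
      forall x y, `|laplacian u x - laplacian u y| <= C * `|x - y|].
Proof.
move=> uB [_ u2] pu.
have p1 i := partial_grad_periodic i pu.
have [C1 C10 C1P] : exists2 K, 0 <= K & forall i x, `|partial i u x| <= K.
  apply: uniform_bound => i; apply: (continuous_periodic_bounded uB) (p1 i).
  exact: (@CkS_continuous 1 _ (u2 i)).
have [C2 C20 C2P] : exists2 K, 0 <= K &
    forall (p : 'I_d * 'I_d) x, `|partial p.1 (partial p.2 u) x| <= K.
  apply: uniform_bound => -[i j] /=; apply: (continuous_periodic_bounded uB).
    by have [_ u3] := u2 j; exact: (@CkS_continuous 0 _ (u3 i)).
  exact: partial_periodic.
have [C3 C30 C3P] : exists2 K, 0 <= K & forall (p : 'I_d * 'I_d * 'I_d) x,
    `|partial p.1.1 (partial p.1.2 (partial p.2 u)) x| <= K.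
  apply: uniform_bound => -[[i j] k] /=; apply: (continuous_periodic_bounded
    uB).
    by have [_ /(_ j)[_ /(_ i)]] := u2 k.
  exact/partial_periodic/partial_periodic.
have lapE x : laplacian u x = \sum_i partial i (partial i u) x by [].
exists (C1 + d%:R * C2 + C2 + d%:R * (d%:R * C3)); first by rewrite !addr_ge0//
  !mulr_ge0.
have N2 : 0 <= d%:R * C2 by rewrite mulr_ge0.
have N3 : 0 <= d%:R * (d%:R * C3) by rewrite !mulr_ge0.
split.
- move=> x; apply: norm_le_coord => [|i]; first by rewrite !addr_ge0.
  by rewrite mxE; have := C1P i x; lra.
- move=> x y; apply: (@le_trans _ _ (d%:R * C2 * `|x - y|)); last first.
    by rewrite ler_wpM2r//; lra.
  apply: norm_le_coord => [|i]; first by rewrite mulr_ge0.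
  rewrite !mxE; apply: bounded_grad_lipschitz => [z|j z]; first by have [] :=
    u2 i.
  exact: (C2P (j, i)).
- by move=> i x; have := C2P (i, i) x => /=; lra.
- move=> x; apply: (@le_trans _ _ (d%:R * C2)); last by lra.
  by rewrite lapE; apply: norm_sum_le => i; exact: (C2P (i, i)).
- move=> x y; apply: (@le_trans _ _ (d%:R * (d%:R * C3) * `|x - y|));
  last first.
    by rewrite ler_wpM2r//; lra.
  rewrite !lapE -sumrB -mulrA; apply: norm_sum_le => i.
  apply: bounded_grad_lipschitz => [z|j z]; first by have [_ /(_ i)[]] := u2 i.
  exact: (C3P (j, i, i)).
Qed.

End regularity.

(** * Flows of Lipschitz fields *)

Section flow_of_lipschitz_field.
Context {R : realType} {d : nat} (v : 'rV[R]_d -> 'rV[R]_d) (l : 'rV[R]_d -> R)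
  (X : R -> 'rV[R]_d -> 'rV[R]_d) (C : R).
Hypothesis C0 : 0 <= C.
Hypothesis vC : forall x, `|v x| <= C.
Hypothesis vL : forall x y, `|v x - v y| <= C * `|x - y|.
Hypothesis flow0 : forall x, X 0 x = x.
Hypothesis flow_solution : forall x, solution v (X ^~ x).

Lemma flow_add s t x : X (t + s) x = X t (X s x).
Proof.
apply: (solution_unique C0 vL (solution_shift s (flow_solution x))
  (flow_solution (X s x))); by rewrite add0r flow0.
Qed.

Lemma flow_translate c : (forall y, v (y + c) = v y) ->
  forall t x, X t (x + c) = X t x + c.
Proof.
move=> vc t x; apply: (solution_unique C0 vL (flow_solution (x + c))
  (solution_translate (flow_solution x) vc)); by rewrite !flow0.
Qed.

Lemma flow_dist t x y :
  `|X t x - X t y| <= d%:R * `|x - y| * expR (@flow_rate R d C * `|t|).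
Proof.
by have := solution_dist C0 vL (flow_solution x) (flow_solution y) t;
  rewrite !flow0.
Qed.

Lemma flow_near h x : `|X h x - x| <= C * `|h|.
Proof.
apply: norm_le_coord => [|i]; first by rewrite mulr_ge0.
have := derive_bound_sym (T := `|h|) (K := C)
  (fun t => is_derive_coord i (flow_solution x t)).
rewrite flow0 !mxE; apply => // t _.
exact: le_trans (norm_coord_le _ _) (vC _).
Qed.

(** Up to time [h] the point moves by at most [C * |h|], so its velocity deviates from [v x] by at
    most [C * C * |h|]. *)
Lemma flow_euler h x : `|X h x - (x + h *: v x)| <= C * C * h ^+ 2.
Proof.
apply: norm_le_coord => [|i]; first by rewrite mulr_ge0 ?sqr_ge0 ?mulr_ge0.
have D (t : R) : is_derive t (1 : R) (fun t => X t x 0 i - (v x) 0 i * t)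
    ((v (X t x)) 0 i - (v x) 0 i).
  exact: is_deriveB (is_derive_coord i (flow_solution x t)) (is_derive_linear _
    _).
have := derive_bound_sym (T := `|h|) (K := C * C * `|h|) D.
rewrite flow0 mulr0 subr0 sqr_normr_mul mulrA => H.
have -> : (X h x - (x + h *: v x)) 0 i =
    X h x 0 i - (v x) 0 i * h - x 0 i by rewrite !mxE; ring.
apply: H => // t th.
rewrite (_ : _ - _ = (v (X t x) - v x) 0 i); last by rewrite !mxE.
rewrite (le_trans (norm_coord_le _ _))// (le_trans (vL _ _))//
  -!mulrA ler_wpM2l//.
by rewrite (le_trans (flow_near _ _))// ler_wpM2l.
Qed.

Variable A : R -> 'rV[R]_d -> R.
Hypothesis lC : forall x, `|l x| <= C.
Hypothesis lL : forall x y, `|l x - l y| <= C * `|x - y|.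
Hypothesis dA : forall x (t : R), is_derive t (1 : R) (A ^~ x) (l (X t x)).
Hypothesis A0 : forall x, A 0 x = 0.

(** As functions of [t] both sides have the derivative [l (X (t + s) x)] and agree at [t = 0]; no
    change of variables in an integral is involved. *)
Lemma flow_integral_add s t x : A (t + s) x = A t (X s x) + A s x.
Proof.
pose f (r : R) := A (r + s) x; pose g (r : R) := A r (X s x).
have df (r : R) : is_derive r (1 : R) f (l (X (r + s) x)).
  have := @is_derive1_comp R (A ^~ x) (shift s) r _ _ (dA x (r + s))
    (is_derive_shift r 1 s).
  by rewrite mulr1.
have dg (r : R) : is_derive r (1 : R) g (l (X (r + s) x)).
  by rewrite flow_add; exact: dA.
have dfg (r : R) : is_derive r (1 : R) (f - g) 0.
  exact: is_derive_eq (is_deriveB (df r) (dg r)) (subrr _).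
have := derive_eq0_constant dfg t 0.
rewrite /f /g !fctE (add0r s) A0 subr0 => <-.
by rewrite [RHS]addrC subrK.
Qed.

Lemma flow_integral_translate c : (forall y, v (y + c) = v y) ->
  (forall y, l (y + c) = l y) -> forall t x, A t (x + c) = A t x.
Proof.
move=> vc lc t x; have dA' (r : R) : is_derive r (1
  : R) (A ^~ (x + c)) (l (X r x)).
  by rewrite -lc -flow_translate.
have D (r : R) : is_derive r (1 : R) (A ^~ (x + c) - A ^~ x) 0.
  exact: is_derive_eq (is_deriveB (dA' r) (dA x r)) (subrr _).
have := derive_eq0_constant D t 0.
by rewrite !fctE !A0 subrr => /eqP; rewrite subr_eq0 => /eqP.
Qed.

(** The constant grows with [T] because the distance between two flow lines is bounded only by an
    exponential in time. *)
Lemma flow_integral_lip T : exists2 D, 0 <= D & forall t x y, `|t| <= T ->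
  `|A t x - A t y| <= D * `|x - y|.
Proof.
pose E := C * (d%:R * expR (@flow_rate R d C * `|T|)).
have E0 : 0 <= E by rewrite !mulr_ge0// expR_ge0.
exists (E * `|T|); first by rewrite mulr_ge0.
move=> t x y tT.
have D s := is_deriveB (dA x s) (dA y s).
have tT' : `|t| <= `|T| by rewrite (le_trans tT)// ler_norm.
have bnd s : `|s| <= `|T| -> `|l (X s x) - l (X s y)| <= E * `|x - y|.
  move=> sT; rewrite (le_trans (lL _ _))// /E -!mulrA ler_wpM2l//.
  rewrite (le_trans (flow_dist _ _ _))// -mulrA ler_wpM2l// mulrC ler_wpM2r//.
  by rewrite ler_expR /flow_rate -!mulrA !ler_wpM2l.
have := derive_bound_sym D bnd tT'.
rewrite !fctE !A0 subrr [X in `|X|]subr0 => H.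
by apply: (le_trans H); rewrite mulrAC ler_wpM2r// ler_wpM2l.
Qed.

Lemma flow_integral_le h x : `|A h x| <= C * `|h|.
Proof.
have := derive_bound_sym (dA x) (fun t _ => lC (X t x)) (lexx `|h|).
by rewrite A0 [X in `|X|]subr0.
Qed.

Lemma flow_integral_euler h x : `|A h x - h * l x| <= C * C * h ^+ 2.
Proof.
have D (t : R) := is_deriveB (dA x t) (is_derive_linear (l x) t).
have bnd t : `|t| <= `|h| -> `|l (X t x) - l x| <= C * C * `|h|.
  move=> th; rewrite (le_trans (lL _ _))// -!mulrA ler_wpM2l//.
  by rewrite (le_trans (flow_near _ _))// ler_wpM2l.
have := derive_bound_sym D bnd (lexx _).
by rewrite !fctE A0 mulr0 subrr [X in `|X|]subr0 sqr_normr_mul mulrA [h *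
  _]mulrC.
Qed.

End flow_of_lipschitz_field.

(** * The penalized supremum of the flow integrals *)

Section exponential_bounds.
Context {R : realType}.
Implicit Types (a b c s : R).

Lemma expR_sub1_le s : `|expR s - 1| <= expR `|s| * `|s|.
Proof.
have bnd t : `|t| <= `|s| -> `|expR t| <= expR `|s|.
  by move=> ts; rewrite ger0_norm ?expR_ge0// ler_expR (le_trans (ler_norm t)).
by have := derive_bound_sym (@is_derive_expR R) bnd (lexx _); rewrite expR0.
Qed.

Lemma expR_sub1_sub_le s : `|expR s - 1 - s| <= expR `|s| * s ^+ 2.
Proof.
have bnd t : `|t| <= `|s| -> `|expR t - 1| <= expR `|s| * `|s|.
  move=> ts; rewrite (le_trans (expR_sub1_le t))// ler_pM// ?expR_ge0//.
  by rewrite ler_expR.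
have D (t : R) := is_deriveB (is_derive_expR t) (is_derive_id t 1).
have := derive_bound_sym D bnd (lexx _).
by rewrite !fctE /= expR0 subr0 addrAC sqr_normr_mul mulrA.
Qed.

Lemma expR_lip c a b : a <= c -> b <= c -> `|expR a - expR b| <= expR c * `|a -
  b|.
Proof.
wlog ab : a b / a <= b => [H ac bc|ac bc].
  have /orP[ab|ba] := le_total a b; first exact: H.
  by rewrite distrC [`|a - b|]distrC; exact: H.
rewrite distrC [`|a - b|]distrC [`|b - a|]ger0_norm ?subr_ge0//.
apply: derive_bound => // t /andP[_ tb].
by rewrite ger0_norm ?expR_ge0// ler_expR (le_trans tb).
Qed.

End exponential_bounds.

Section weighted_supremum.
Context {R : realType} {d : nat} (X : R -> 'rV[R]_d -> 'rV[R]_d)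
  (A : R -> 'rV[R]_d -> R) (c : R).
Hypothesis Ac : forall t x, `|A t x| <= c.
Hypothesis A0 : forall x, A 0 x = 0.
Hypothesis A_add : forall s t x, A (t + s) x = A t (X s x) + A s x.
Hypothesis A_lip : forall T : R, exists2 D, 0 <= D & forall t x y, `|t| <= T ->
  `|A t x - A t y| <= D * `|x - y|.

(* Penalizing large times by [e * |t|] makes the supremum of [A t x] Lipschitz
   in [x], at the price of an error [e * |h|] along the flow. *)
Definition wsup (e : R) (x : 'rV[R]_d) : R :=
  sup [set r | exists t : R, r = A t x - e * `|t|].

Lemma wsup_ub (e t : R) x : 0 <= e -> A t x - e * `|t| <= wsup e x.
Proof.
move=> e0; apply: ub_le_sup; last by exists t.
exists c => _ [s ->]; rewrite lerBlDr (le_trans (ler_norm _))//.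
by rewrite (le_trans (Ac _ _))// lerDl mulr_ge0.
Qed.

Lemma wsup_le (e y : R) x : (forall t : R, A t x - e * `|t| <= y) ->
  wsup e x <= y.
Proof.
move=> H; apply: ge_sup; last by move=> _ [s ->].
by exists (A 0 x - e * `|0 : R|), 0.
Qed.

Lemma wsup_ge0 (e : R) x : 0 <= e -> 0 <= wsup e x.
Proof. by move=> e0; have := wsup_ub 0 x e0; rewrite A0 normr0 mulr0 subr0. Qed.

Lemma wsup_le_bound (e : R) x : 0 <= e -> wsup e x <= c.
Proof.
move=> e0; apply: wsup_le => t; rewrite lerBlDr (le_trans (ler_norm _))//.
by rewrite (le_trans (Ac _ _))// lerDl mulr_ge0.
Qed.

(** The cocycle identity turns the supremum at [X h x] into the one at [x] with times shifted by
    [h], and the shift changes the penalty by at most [e * |h|]. For [e = 0] the relation is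
    exact. *)
Lemma wsup_flow (e h : R) x : 0 <= e ->
  `|wsup e (X h x) + A h x - wsup e x| <= e * `|h|.
Proof.
move=> e0; rewrite ler_distl; apply/andP; split.
  rewrite lerBlDr; apply: wsup_le => t.
  have := wsup_ub (t - h) (X h x) e0; have := A_add h (t - h) x.
  have := ler_wpM2l e0 (ler_normB t h); rewrite subrK mulrDr => H -> ?.
  by lra.
rewrite -lerBrDr; apply: wsup_le => t.
have := wsup_ub (t + h) x e0; rewrite A_add.
by have := ler_wpM2l e0 (ler_normD t h); rewrite mulrDr => ? ?; lra.
Qed.

(** For [|t| > c / e] the penalized value is negative, whereas the supremum is nonnegative because
    of [t = 0]. Only [|t| <= c / e] matters, and there [A] has a uniform Lipschitz constant in
    [x]. *)
Lemma wsup_lip (e : R) : 0 < e -> exists2 D, 0 <= D &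
  forall x y, `|wsup e x - wsup e y| <= D * `|x - y|.
Proof.
move=> e0; have [D D0 DP] := A_lip (c / e).
exists D => //; suff H x y : wsup e x <= wsup e y + D * `|x - y|.
  by move=> x y; rewrite ler_distl lerBlDr H andbT distrC H.
apply: wsup_le => t; have [tT|tT] := leP `|t| (c / e).
  have := DP t x y tT; have := wsup_ub t y (ltW e0); rewrite ler_distl.
  by move=> ? /andP[? ?]; lra.
have := wsup_ge0 y (ltW e0); have : 0 <= D * `|x - y| by rewrite mulr_ge0.
move: tT; rewrite ltr_pdivrMr// mulrC => ?; have := Ac t x.
by rewrite ler_norml => /andP[? ?] ? ?; lra.
Qed.

Lemma wsup_eq (e : R) x y : (forall t, A t x = A t y) -> wsup e x = wsup e y.
Proof. by move=> H; rewrite /wsup; under eq_set => r do under eq_exists =>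
  t do rewrite H. Qed.

(** The unpenalized supremum is reached up to [e / 2] at some fixed time [t], and the penalty at
    that [t] tends to [0]. The convergence is only pointwise in [x]. *)
Lemma wsup_cvg x : (fun n => wsup n.+1%:R^-1 x) @ \oo --> wsup 0 x.
Proof.
apply/cvgrPdist_le => e e0.
have e20 : 0 < e / 2 by rewrite divr_gt0.
have [t tP] : exists t, wsup 0 x - e / 2 < A t x.
  apply: contrapT => /forallNP H.
  suff : wsup 0 x <= wsup 0 x - e / 2 by rewrite lerBrDr gerDl leNgt e20.
  by apply: wsup_le => t; rewrite mul0r subr0 leNgt; apply/negP/H.
near=> n; have n0 : 0 <= n.+1%:R^-1 :> R by [].
have mono : wsup n.+1%:R^-1 x <= wsup 0 x.
  apply: wsup_le => s; rewrite (le_trans _ (wsup_ub s x (lexx 0)))//.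
  by rewrite mul0r subr0 lerBlDr lerDl mulr_ge0.
rewrite ger0_norm ?subr_ge0// lerBlDl.
have small : n.+1%:R^-1 * `|t| <= e / 2.
  rewrite ler_pdivrMl// -ler_pdivrMr//.
  rewrite (@le_trans _ _ n%:R)//; last by rewrite ler_nat.
  by near: n; exact: nbhs_infty_ger.
have := wsup_ub t x n0; move: (n.+1%:R^-1) small => k kt ktw.
by move: (k * `|t|) kt ktw => kt ? ?; lra.
Unshelve. all: by end_near. Qed.

End weighted_supremum.

(** * The flux of the penalized conductivity is of the order of the penalty *)

Section flux_of_weighted_supremum.
Context {R : realType} {d : nat} (v : 'rV[R]_d -> 'rV[R]_d)
  (w : 'I_d -> 'rV[R]_d -> R) (l : 'rV[R]_d -> R)
  (X : R -> 'rV[R]_d -> 'rV[R]_d) (A : R -> 'rV[R]_d -> R) (C c : R).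
Hypothesis C0 : 0 <= C.
Hypothesis vC : forall x, `|v x| <= C.
Hypothesis vL : forall x y, `|v x - v y| <= C * `|x - y|.
Hypothesis wC : forall i x, `|w i x| <= C.
Hypothesis wc : forall i, continuous (w i).
Hypothesis vw : forall i x (t : R),
  is_derive t (1 : R) (fun s : R => v (x + s *: 'e_i) 0 i) (w i (x + t *:
    'e_i)).
Hypothesis lw : forall x, l x = \sum_i w i x.
Hypothesis lC : forall x, `|l x| <= C.
Hypothesis lL : forall x y, `|l x - l y| <= C * `|x - y|.
Hypothesis flow0 : forall x, X 0 x = x.
Hypothesis flow_solution : forall x, solution v (X ^~ x).
Hypothesis dA : forall x (t : R), is_derive t (1 : R) (A ^~ x) (l (X t x)).
Hypothesis A0 : forall x, A 0 x = 0.
Hypothesis Ac : forall t x, `|A t x| <= c.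

Variables (phi p : 'rV[R]_d -> R) (M P : R).
Hypothesis P0 : 0 <= P.
Hypothesis phiL : lip P phi.
Hypothesis phiP : forall x, `|phi x| <= P.
Hypothesis phiM : supported_in M phi.
Hypothesis pc : continuous p.
Hypothesis pP : forall x, `|p x| <= P.
Hypothesis pM : supported_in M p.
(** [p] stands for the derivative of [phi] along [v]; this second-order expansion is what ties it to
    [phi]. *)
Hypothesis phi_flow : forall h x, `|phi (X h x) - phi x - h * p x| <= P * h ^+
  2.

Let A_add := flow_integral_add C0 vL flow0 flow_solution dA A0.
Let A_lip := flow_integral_lip C0 vL flow0 flow_solution lL dA A0.

Lemma le_of_small_error (a b B : R) :
  (forall h, 0 < h <= 1 -> a <= B * h + b) -> a <= b.
Proof.
move=> H; rewrite leNgt; apply/negP => ba.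
(* A positive majorant of [B]; with [h] at most [(a - b) / (2 * B')] the error absorbs only half of
   the gap [a - b]. *)
pose B' := `|B| + 1; have B'0 : 0 < B' by rewrite ltr_wpDl.
pose h := Num.min 1 ((a - b) / (2 * B')).
have h0 : 0 < h by rewrite lt_min ltr01 divr_gt0 ?subr_gt0// mulr_gt0.
have /H : 0 < h <= 1 by rewrite h0 ge_min lexx.
have : B * h <= (a - b) / 2.
  apply: (@le_trans _ _ (B' * h)).
    by rewrite ler_wpM2r ?(ltW h0)// (le_trans (ler_norm B))// lerDl.
  rewrite mulrC -ler_pdivlMr// (le_trans (_ : h <= (a - b) / (2 * B'))) //.
    by rewrite ge_min lexx orbT.
  by rewrite invfM mulrA.
by lra.
Qed.

Let s (e : R) := wsup A e.

Let g (e : R) (x : 'rV[R]_d) := expR (s e x) * phi x.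

Let ge_lip (e : R) : 0 < e -> exists2 G, 0 <= G & lip G (g e).
Proof.
move=> e0; have [D D0 DP] := wsup_lip Ac A0 A_lip e0.
exists (expR c * D * P + expR c * P); first by rewrite addr_ge0 ?mulr_ge0
  ?expR_ge0.
move=> x y.
have -> : g e x - g e y = (expR (s e x) - expR (s e y)) * phi x +
  expR (s e y) * (phi x - phi y) by rewrite /g; ring.
have sc z : s e z <= c by exact: wsup_le_bound Ac _ _ (ltW e0).
rewrite (le_trans (ler_normD _ _))// [leRHS]mulrDl !normrM lerD//.
  rewrite mulrAC ler_pM//; rewrite (le_trans (expR_lip (sc x) (sc y)))//.
  by rewrite -mulrA ler_wpM2l ?expR_ge0//; exact: DP.
by rewrite -mulrA ler_pM// ger0_norm ?expR_ge0// ler_expR.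
Qed.

(** Along the flow the exponent changes by [D], which is [- h * l x] up to [e * |h|] and a term in
    [h^2]. The bound uses only this and not the Lipschitz constant of the supremum, so the
    coefficient of [h^2] is independent of [e]. *)
Lemma flow_expansion_bound (e h : R) (x : 'rV[R]_d) : 0 < e -> e <= 1 ->
  `|h| <= 1 ->
  `|g e (X h x) - g e x + h * (g e x * l x) - h * (expR (s e x) * p x)| <=
  expR c * (P * expR (C + 1) * (1 + (C + 1) + (C + 1) ^+ 2) + C * C * P) * h ^+
    2 +
  expR c * P * e * `|h|.
Proof.
move=> e0 e1 h1; pose D := s e (X h x) - s e x; pose E := expR (C + 1).
have hh := sqr_normr_mul h.
have DA : `|D + A h x| <= e * `|h|.
  by have := wsup_flow Ac A_add h x (ltW e0); rewrite /D addrAC.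
have Ah : `|A h x| <= C * `|h| := flow_integral_le lC dA A0 h x.
have Al := flow_integral_euler C0 vC flow0 flow_solution lL dA A0 h x.
have D1 : `|D| <= (C + 1) * `|h|.
  have -> : D = (D + A h x) - A h x by rewrite addrK.
  rewrite (le_trans (ler_normB _ _))// addrC mulrDl lerD// (le_trans DA)//.
  by rewrite ler_wpM2r.
have D2 : `|D + h * l x| <= C * C * h ^+ 2 + e * `|h|.
  have -> : D + h * l x = (D + A h x) - (A h x - h * l x) by ring.
  by rewrite (le_trans (ler_normB _ _))// addrC lerD.
have C10 : 0 <= C + 1 by rewrite addr_ge0.
have DE : expR `|D| <= E.
  by rewrite ler_expR (le_trans D1)// -[leRHS]mulr1 ler_wpM2l.
have D'E : expR D <= E by rewrite (le_trans _ DE)// ler_expR ler_norm.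
(* Four errors: the remainder of [phi], the product of two first-order increments, the remainder of
   the exponential, and the deviation of [D] from [- h * l x]. Only the last one contributes the
   term in [e * |h|]. *)
have -> : g e (X h x) - g e x + h * (g e x * l x) - h * (expR (s e x) * p x) =
  expR (s e x) * (expR D * (phi (X h x) - phi x - h * p x) +
    (expR D - 1) * (h * p x) + (expR D - 1 - D) * phi x + (D + h * l x) * phi
      x).
  rewrite /g; have -> : s e (X h x) = s e x + D by rewrite /D subrKC.
  by rewrite expRD; ring.
rewrite normrM [`|expR _|]ger0_norm ?expR_ge0//.
have -> : expR c * (P * E * (1 + (C + 1) + (C + 1) ^+ 2) + C * C * P) * h ^+ 2 +
    expR c * P * e * `|h| =
  expR c * (E * (P * h ^+ 2) + E * ((C + 1) * `|h|) * (`|h| * P) +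
    E * ((C + 1) * `|h|) ^+ 2 * P + (C * C * h ^+ 2 + e * `|h|) * P).
  by rewrite hh; ring.
rewrite ler_pM ?expR_ge0//; first by rewrite ler_expR;
  exact: wsup_le_bound Ac _ _ (ltW e0).
apply: le_trans (ler_normD _ _) _; apply: lerD; last by rewrite normrM ler_pM.
apply: le_trans (ler_normD _ _) _; apply: lerD; last first.
  rewrite normrM ler_pM// (le_trans (expR_sub1_sub_le D))//.
  rewrite ler_pM ?expR_ge0 ?sqr_ge0// sqr_normr_mul -expr2.
  by rewrite lerXn2r// nnegrE mulr_ge0.
apply: le_trans (ler_normD _ _) _; apply: lerD.
  by rewrite normrM ler_pM// ger0_norm ?expR_ge0.
rewrite normrM ler_pM//; last by rewrite normrM ler_wpM2l.
by rewrite (le_trans (expR_sub1_le D))// ler_pM// ?expR_ge0.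
Qed.

(** The integral of [g e (x + h *: v x) - g e x] is expanded in two ways: by the divergence theorem
    at first order, and by the flow, which adds [h] times the flux. Subtracting, dividing by [h] and
    letting [h] tend to [0] leaves the flux bounded by the error in [e]. [D1] and [D3] may depend on
    [e], but they disappear in the limit and [K] does not depend on it. *)
Lemma wsup_flux_bound : exists K : R, forall e : R, 0 < e -> e <= 1 ->
  `|\int[@rV_lebesgue R d]_x (expR (wsup A e x) * p x)| <= K * e.
Proof.
pose V := fine (@rV_lebesgue R d (cube (M + C))).
exists (expR c * P * V) => e e0 e1.
have [G G0 gL] := ge_lip e0.
have gM : supported_in M (g e) by move=> x Mx; rewrite /g phiM// mulr0.
have [D1 D1P] := integral_euler_step C0 C0 vL vC wC wc vw M G0.
set D2 := expR c * (P * expR (C + 1) * (1 + (C + 1) + (C + 1) ^+ 2) + C * C *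
  P).
pose D3 := G * (C * C) + D2.
have [D D0 DP] := wsup_lip Ac A0 A_lip e0.
have cs : continuous (s e) := lipschitz_continuous DP.
have ces : continuous (fun x => expR (s e x)).
  exact: continuous_fun_comp cs (@continuous_expR R).
have cg := lip_continuous gL.
have cl : continuous l := lipschitz_continuous lL.
have cesp := continuous_mul ces pc.
have cgl := continuous_mul cg cl.
pose I := \int[@rV_lebesgue R d]_x (expR (s e x) * p x).
apply: (le_of_small_error (B := D1 + D3 * V)) => h /andP[h0 h1].
have nh : `|h| = h by rewrite ger0_norm// ltW.
have h1' : `|h| <= 1 by rewrite nh.
have cv : continuous (fun x : 'rV[R]_d => x + h *: v x).
  apply: (@lipschitz_continuous R _ _ _ (1 + `|h| * C)) => x y.
  rewrite opprD addrACA -scalerBr (le_trans (ler_normD _ _))//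
    mulrDl mul1r lerD2l.
  by rewrite normrZ -mulrA ler_wpM2l.
have cgv := continuous_fun_comp cv cg.
have gvM : supported_in (M + C) (fun x => g e (x + h *: v x)).
  apply: supported_comp_near gM => x; rewrite addrC addKr normrZ.
  by rewrite -[leRHS]mul1r ler_pM.
have glM : supported_in M (fun x => g e x * l x) := supported_mulr l gM.
have espM : supported_in M (fun x => expR (s e x) * p x).
  by move=> x Mx; rewrite pM// mulr0.
(* The flow expansion with [X h x] replaced by the Euler step, at the cost of [G * (C * C)] in the
   coefficient of [h^2]. *)
pose r x := g e (x + h *: v x) - g e x + (h * (g e x * l x) - h * (expR (s e x)
  * p x)).
have rP x : `|r x| <= (D3 * h + expR c * P * e) * h.
  have -> : r x = (g e (x + h *: v x) - g e (X h x)) +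
    (g e (X h x) - g e x + h * (g e x * l x) - h * (expR (s e x) * p x)).
    by rewrite /r; ring.
  have -> : (D3 * h + expR c * P * e) * h = G * (C * C * h ^+ 2) +
      (D2 * h ^+ 2 + expR c * P * e * `|h|) by rewrite /D3 nh; ring.
  rewrite (le_trans (ler_normD _ _))// lerD//; last exact: flow_expansion_bound.
  rewrite (le_trans (gL _ _))// ler_wpM2l// distrC.
  exact: flow_euler.
have MC : M <= M + C by rewrite lerDl.
have hglM : supported_in M (fun x => h * (g e x * l x)).
  by move=> x Mx; rewrite glM// mulr0.
have hespM : supported_in M (fun x => h * (expR (s e x) * p x)).
  by move=> x Mx; rewrite espM// mulr0.
have chgl := continuous_mul (@continuous_cst _ _ h) cgl.
have chesp := continuous_mul (@continuous_cst _ _ h) cesp.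
have cr1 := continuous_sub cgv cg.
have cr2 := continuous_sub chgl chesp.
have r1M : supported_in (M + C) (fun x => g e (x + h *: v x) - g e x).
  by move=> x Mx; rewrite gvM// gM ?subrr// (le_lt_trans MC).
have r2M : supported_in M (fun x => h * (g e x * l x) - h * (expR (s e x) * p
  x)).
  by move=> x Mx; rewrite hglM// hespM// subrr.
have rM : supported_in (M + C) r.
  by move=> x Mx; rewrite /r r1M// r2M ?addr0// (le_lt_trans MC).
have := supported_integral_bound (continuous_add cr1 cr2) rM rP.
rewrite (integral_supportedD cr1 cr2 r1M r2M) (integral_supportedB cgv cg gvM
  gM).
rewrite (integral_supportedB chgl chesp hglM hespM).
rewrite (integral_supportedZ h cgl glM) (integral_supportedZ h cesp espM) -/I
  -/V.
have lwE : (fun x => g e x * l x) = (fun x => g e x * \sum_i w i x).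
  by apply/funext => x; rewrite lw.
have := D1P h (g e) h1' gL gM; rewrite -lwE.
set I1 := \int[_]_x _ ; set I2 := \int[_]_x _ ; set I3 := \int[_]_x _.
move=> H1 H2; suff : `|I| * h <= ((D1 + D3 * V) * h + expR c * P * V * e) * h
  by rewrite ler_pM2r.
have -> : `|I| * h = `|h * I| by rewrite normrM nh mulrC.
have -> : h * I = (I1 - I2 + h * I3) - (I1 - I2 + (h * I3 - h * I)) by ring.
rewrite (le_trans (ler_normB _ _))//.
rewrite (le_trans (lerD H1 H2))// le_eqVlt; apply/orP; left; apply/eqP; ring.
Qed.

End flux_of_weighted_supremum.

(** * Test functions *)

Section test_functions.
Context {R : realType} {d : nat}.
Implicit Types (f phi : 'rV[R]_d -> R) (M : R).

Lemma supported_partial M f i : supported_in M f ->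
  supported_in M (partial i f).
Proof.
move=> fM x Mx; rewrite /partial (@near_eq_derive _ _ _ f (cst 0))
  ?derive_cst//.
have oM : open [set y : 'rV[R]_d | M < `|y|].
  by apply: open_comp (@open_gt R M) => // y _; exact: norm_continuous.
have : nbhs x [set y : 'rV[R]_d | M < `|y|] by exact: open_nbhs_nbhs.
by apply: filterS => y /= /fM.
Qed.

Lemma compactly_supported_supported f : compactly_supported f ->
  exists M, supported_in M f.
Proof.
move=> /compact_bounded[M [_ fM]]; exists (M + 1) => x Mx.
apply/eqP; apply: contraTT Mx => fx; rewrite -leNgt.
have M1 : M < M + 1 by rewrite ltrDl.
apply: (fM (M + 1) M1).
exact: subset_closure.
Qed.

Lemma Cinfty_partial f i : Cinfty f -> Cinfty (partial i f).
Proof. by move=> fC k; have [_] := fC k.+1; exact. Qed.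

Lemma Cinfty_differentiable f : Cinfty f -> forall x, differentiable f x.
Proof. by move=> fC; have [] := fC 1%N. Qed.

Lemma Cinfty_continuous f : Cinfty f -> continuous f.
Proof. by move=> fC; have := fC 0%N. Qed.

Lemma test_function_bounds phi M : Cinfty phi -> supported_in M phi ->
  exists2 Q, 0 <= Q & [/\ lip Q phi, forall x, `|phi x| <= Q,
    forall i, lip Q (partial i phi) & forall i x, `|partial i phi x| <= Q].
Proof.
move=> pC pM; have p1 i := Cinfty_partial i pC.
have p1M i := supported_partial i pM.
have [Q0 Q00 Q0P] := continuous_supported_bounded (Cinfty_continuous pC) pM.
have [Q1 Q10 Q1P] : exists2 Q, 0 <= Q & forall i x, `|partial i phi x| <= Q.
  apply: uniform_bound => i.
  by have [Q _] := continuous_supported_bounded (Cinfty_continuous (p1 i)) (p1M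
    i); exists Q.
have [Q2 Q20 Q2P] : exists2 Q, 0 <= Q &
    forall (q : 'I_d * 'I_d) x, `|partial q.1 (partial q.2 phi) x| <= Q.
  apply: uniform_bound => -[i j] /=.
  have p2 := Cinfty_continuous (Cinfty_partial i (p1 j)).
  by have [Q _] := continuous_supported_bounded p2 (supported_partial i (p1M
    j)); exists Q.
have N1 : 0 <= d%:R * Q1 by rewrite mulr_ge0.
have N2 : 0 <= d%:R * Q2 by rewrite mulr_ge0.
exists (Q0 + Q1 + d%:R * Q1 + d%:R * Q2); first by rewrite !addr_ge0.
split.
- move=> x y; apply: (@le_trans _ _ (d%:R * Q1 * `|x - y|)).
    exact: (bounded_grad_lipschitz (Cinfty_differentiable pC) Q1P).
  by rewrite ler_wpM2r//; lra.
- by move=> x; have := Q0P x; lra.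
- move=> i x y; apply: (@le_trans _ _ (d%:R * Q2 * `|x - y|)).
    apply: (bounded_grad_lipschitz (Cinfty_differentiable (p1 i))) => j z.
    exact: (Q2P (j, i)).
  by rewrite ler_wpM2r//; lra.
- by move=> i x; have := Q1P i x; lra.
Qed.

(** Each factor has one constant serving both as bound and as Lipschitz constant, whence
    [2 * (C * D)]. *)
Lemma lip_mul (C D : R) f g : (forall x, `|f x| <= C) -> (forall x,
  `|g x| <= D) ->
  lip C f -> lip D g -> lip (2 * (C * D)) (fun x => f x * g x).
Proof.
move=> fC gD fL gL x y.
have -> : f x * g x - f y * g y = (f x - f y) * g x + f y * (g x - g y) by ring.
have -> : 2 * (C * D) * `|x - y| = C * `|x - y| * D + C * (D * `|x - y|)
  by ring.
by rewrite (le_trans (ler_normD _ _))// lerD// normrM ler_pM.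
Qed.

Lemma lip_dotp (C D : R) (v w : 'rV[R]_d -> 'rV[R]_d) :
  (forall i x, `|v x 0 i| <= C) -> (forall i x, `|w x 0 i| <= D) ->
  (forall i, lip C (fun x => v x 0 i)) -> (forall i, lip D (fun x =>
    w x 0 i)) ->
  lip (d%:R * (2 * (C * D))) (fun x => dotp (v x) (w x)).
Proof.
move=> vC wD vL wL x y; rewrite -sumrB -mulrA; apply: norm_sum_le => i.
exact: (lip_mul (vC i) (wD i) (vL i) (wL i)).
Qed.

Lemma dotp_bound (C D : R) (v w : 'rV[R]_d) :
  (forall i, `|v 0 i| <= C) -> (forall i, `|w 0 i| <= D) ->
  `|dotp v w| <= d%:R * (C * D).
Proof. by move=> vC wD; apply: norm_sum_le => i; rewrite normrM ler_pM. Qed.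

Lemma dotp_gt0 (v : 'rV[R]_d) : v != 0 -> 0 < dotp v v.
Proof.
move=> v0; have vv i : 0 <= v 0 i * v 0 i by rewrite -expr2 sqr_ge0.
rewrite lt_neqAle sumr_ge0// andbT eq_sym; apply: contra v0.
rewrite psumr_eq0// => /allP vE; apply/eqP/rowP => i; rewrite mxE.
by have := vE i (mem_index_enum i); rewrite mulf_eq0 orbb => /eqP.
Qed.

Lemma dotpC (v w : 'rV[R]_d) : dotp v w = dotp w v.
Proof. by apply: eq_bigr => i _; rewrite mulrC. Qed.

End test_functions.

(** * Realizability *)

Section realizability_of_supremum.
Context {R : realType} {d : nat} (v : 'rV[R]_d -> 'rV[R]_d)
  (w : 'I_d -> 'rV[R]_d -> R) (l : 'rV[R]_d -> R)
  (X : R -> 'rV[R]_d -> 'rV[R]_d) (A : R -> 'rV[R]_d -> R) (C c : R).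
Hypothesis C0 : 0 <= C.
Hypothesis vC : forall x, `|v x| <= C.
Hypothesis vL : forall x y, `|v x - v y| <= C * `|x - y|.
Hypothesis wC : forall i x, `|w i x| <= C.
Hypothesis wc : forall i, continuous (w i).
Hypothesis vw : forall i x (t : R),
  is_derive t (1 : R) (fun s : R => v (x + s *: 'e_i) 0 i) (w i (x + t *:
    'e_i)).
Hypothesis lw : forall x, l x = \sum_i w i x.
Hypothesis lC : forall x, `|l x| <= C.
Hypothesis lL : forall x y, `|l x - l y| <= C * `|x - y|.
Hypothesis flow0 : forall x, X 0 x = x.
Hypothesis flow_solution : forall x, solution v (X ^~ x).
Hypothesis dA : forall x (t : R), is_derive t (1 : R) (A ^~ x) (l (X t x)).
Hypothesis A0 : forall x, A 0 x = 0.
Hypothesis Ac : forall t x, `|A t x| <= c.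

Let A_lip := flow_integral_lip C0 vL flow0 flow_solution lL dA A0.

Lemma wsup_continuous (e : R) : 0 < e -> continuous (fun x =>
  expR (wsup A e x)).
Proof.
move=> e0; have [D _ DP] := wsup_lip Ac A0 A_lip e0.
exact: continuous_fun_comp (lipschitz_continuous DP) (@continuous_expR R).
Qed.

Lemma expR_wsup_cvg x :
  (fun n => expR (wsup A n.+1%:R^-1 x)) @ \oo --> expR (wsup A 0 x).
Proof.
apply: continuous_cvg; first exact: continuous_expR.
exact: wsup_cvg Ac x.
Qed.

(** A pointwise limit of continuous functions. The outer [f] is arbitrary so that the conductivity
    and its inverse are treated together. *)
Lemma measurable_wsup0 (f : R -> R) : continuous f ->
  measurable_fun [set: 'rV[R]_d]
  ((fun x => f (wsup A 0 x)) : 'rV[R]_d -> measurableTypeR R).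
Proof.
move=> cf; apply: (@measurable_realfun.measurable_fun_cvg _ _ _ _
  (fun n x => f (wsup A n.+1%:R^-1 x))) => [n|x _].
  have k0 : 0 < n.+1%:R^-1 :> R by [].
  have [D _ DP] := wsup_lip Ac A0 A_lip k0.
  apply: continuous_measurable_rV.
  exact: continuous_fun_comp (lipschitz_continuous DP) cf.
by apply: continuous_cvg; [exact: cf|exact: wsup_cvg Ac x].
Qed.

(** The flux bound is used with the penalties [n.+1%:R^-1], so the fluxes tend to [0]. They also
    tend to the flux without penalty, by dominated convergence with majorant [expR c * |p x|]. *)
Lemma wsup_realizable : isotropically_realizable v (fun x => expR (wsup A 0 x)).
Proof.
move=> phi phiC /compactly_supported_supported[M phiM].
have [Q Q0 [phiL phiQ dphiL dphiQ]] := test_function_bounds phiC phiM.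
pose p x := dotp (v x) (grad phi x).
have vC' i x : `|v x 0 i| <= C by rewrite (le_trans (norm_coord_le _ _)).
have gQ i x : `|grad phi x 0 i| <= Q by rewrite mxE.
have gL i : lip Q (fun x => grad phi x 0 i).
  by move=> x y; rewrite !mxE; exact: dphiL.
have pL : lip (d%:R * (2 * (C * Q))) p.
  apply: lip_dotp => // i; exact: vcoord_lip.
have pC := lip_continuous pL.
have CQ0 : 0 <= d%:R * (C * Q) by rewrite !mulr_ge0.
have pQ x : `|p x| <= d%:R * (C * Q) by apply: dotp_bound.
have pM : supported_in M p.
  move=> x Mx; rewrite /p /dotp big1// => i _.
  by rewrite [X in _ * X]mxE (supported_partial i phiM) ?mulr0.
(* One constant for everything: [Q] for [phi] and its Lipschitz constant, [d * (C * Q)] for [p], and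
   the Lipschitz constant of [p] times the speed [C] for the second-order remainder. *)
pose P := Q + d%:R * (C * Q) + d%:R * (2 * (C * Q)) * C.
have N1 : 0 <= d%:R * (2 * (C * Q)) * C by rewrite !mulr_ge0.
have P0 : 0 <= P by rewrite !addr_ge0.
have phi_flow h x : `|phi (X h x) - phi x - h * p x| <= P * h ^+ 2.
  have D (t : R) : is_derive t (1 : R) (fun t =>
    phi (X t x) - p x * t) (p (X t x) - p x).
    apply: is_deriveB (is_derive_linear (p x) t).
    rewrite /p dotpC; apply: is_derive_along (flow_solution x t).
    exact: Cinfty_differentiable.
  have bnd t : `|t| <= `|h| -> `|p (X t x) - p x| <= d%:R * (2 * (C * Q)) * C *
    `|h|.
    move=> th; rewrite (le_trans (pL _ _))//
      -[leRHS]mulrA ler_wpM2l ?mulr_ge0//.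
    rewrite (le_trans (flow_near C0 vC flow0 flow_solution _ _))// ler_wpM2l//.
  have := derive_bound_sym D bnd (lexx _).
  rewrite flow0 mulr0 subr0 addrAC [p x * h]mulrC -[leRHS]mulrA -sqr_normr_mul
    => /le_trans; apply.
  by rewrite ler_wpM2r ?sqr_ge0// /P; lra.
have phiL' : lip P phi by move=> x y; rewrite (le_trans (phiL x y))//
  ler_wpM2r// /P; lra.
have phiP x : `|phi x| <= P by rewrite (le_trans (phiQ x))// /P; lra.
have pP x : `|p x| <= P by rewrite (le_trans (pQ x))// /P; lra.
have [K KP] := wsup_flux_bound C0 vC vL wC wc vw lw lC lL flow0 flow_solution dA
  A0 Ac P0 phiL' phiP phiM pC pP pM phi_flow.
pose f n x := expR (wsup A n.+1%:R^-1 x) * p x.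
pose I n := \int[@rV_lebesgue R d]_x f n x.
have k0 n : 0 < n.+1%:R^-1 :> R by [].
have fP n x : `|f n x| <= expR c * `|p x|.
  rewrite normrM ler_wpM2r// ger0_norm ?expR_ge0// ler_expR.
  exact: wsup_le_bound Ac _ _ (ltW (k0 n)).
have cf n : continuous (f n) by apply: continuous_mul => //;
  exact: wsup_continuous.
have fM n : supported_in M (f n) by move=> x Mx; rewrite /f pM// mulr0.
have cg : continuous (fun x => expR c * `|p x|).
  apply: continuous_mul; first exact: continuous_cst.
  exact: continuous_fun_comp pC (@norm_continuous _ _).
have gM : supported_in M (fun x => expR c * `|p x|).
  by move=> x Mx; rewrite pM// normr0 mulr0.
have mf n := measurable_int _ (continuous_supported_integrable (cf n) (fM n)).
have mp := continuous_measurable_rV pC.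
have [] := @dominated_convergence _ _ _ (@rV_lebesgue R d) setT measurableT
  (fun n => EFin \o f n) (EFin \o (fun x => expR (wsup A 0 x) * p x))
  (EFin \o (fun x => expR c * `|p x|)) mf.
- apply/measurable_realfun.measurable_EFinP/measurable_realfun.measurable_funM
  => //.
  exact: measurable_wsup0 (@continuous_expR R).
- apply: aeW => x _ /=; apply: cvg_EFin; first exact: nearW.
  by apply: cvgM; [exact: expR_wsup_cvg|exact: cvg_cst].
- exact: continuous_supported_integrable cg gM.
- by apply: aeW => x n _ /=; rewrite lee_fin; exact: fP.
move=> fi _ cvgI; apply/eqP.
have I0 : I n @[n --> \oo] --> (0 : R).
  apply/cvgrPdist_le => e e0; near=> n; rewrite sub0r normrN.
  have n1 : n.+1%:R^-1 <= 1 :> R by rewrite invf_le1 ?ler1n.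
  rewrite (le_trans (KP _ (k0 n) n1))// ler_pdivrMr// -ler_pdivrMl//.
  rewrite (@le_trans _ _ n%:R)//; last by rewrite ler_nat.
  by near: n; exact: nbhs_infty_ger.
have /fine_cvg cvgI' : (fun n => (\int[@rV_lebesgue R d]_x (EFin \o f n) x)%E)
  @ \oo -->
    ((\int[@rV_lebesgue R d]_x (expR (wsup A 0 x) * p x))%:E).
  by rewrite /Rintegral fineK ?(integrable_fin_num _ fi)//; exact: cvgI.
by apply/eqP; exact: cvg_unique cvgI' I0.
Unshelve. all: by end_near. Qed.

End realizability_of_supremum.

(** * Bump functions *)

Section flat_functions.
Context {R : realType}.
Implicit Types (p : {poly R}) (s t : R).

(** Half of the exponent pays for the polynomial of smaller degree, the other half for the factor
    [s], which is at most [(e / 2)^-1 * expR (e / 2 * s)]. Hence the quantification over [e] inside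
    the induction. *)
Lemma horner_le_expR p : forall e, 0 < e ->
  exists2 K, 0 <= K & forall s, 0 <= s -> `|p.[s]| <= K * expR (e * s).
Proof.
elim/poly_ind: p => [|p a IH] e e0.
  by exists 0 => // s _; rewrite horner0 normr0 mul0r.
have e20 : 0 < e / 2 by rewrite divr_gt0.
have [K K0 KP] := IH _ e20.
exists (K * (e / 2)^-1 + `|a|); first by rewrite addr_ge0// mulr_ge0//
  invr_ge0 ltW.
move=> s s0; rewrite hornerMXaddC (le_trans (ler_normD _ _))// mulrDl lerD//.
  rewrite normrM (ger0_norm s0) {2}(splitr e) mulrDl expRD mulrACA.
  rewrite ler_pM//; first exact: KP.
  rewrite -ler_pdivrMl ?invr_gt0// invrK.
  by rewrite (le_trans _ (expR_ge1Dx _))// lerDr.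
by rewrite ler_peMr// -expR0 ler_expR mulr_ge0// ltW.
Qed.

(* The smooth functions [p(1/t) exp(-1/t)], extended by [0] to [t <= 0], are
   stable under derivation. *)
Definition flat p t : R := if 0 < t then p.[t^-1] * expR (- t^-1) else 0.

Lemma flat_le0 p t : t <= 0 -> flat p t = 0.
Proof. by rewrite /flat ltNge => ->. Qed.

Lemma flat_gt0 p t : 0 < t -> flat p t = p.[t^-1] * expR (- t^-1).
Proof. by rewrite /flat => ->. Qed.

(** The exponential bound is applied to ['X^2 * p] at [s = t^-1]. Quadratic decay gives the
    derivative [0] at the origin, the only point where the two branches meet. *)
Lemma flat_quadratic p : exists K, forall t, `|flat p t| <= K * t ^+ 2.
Proof.
have [K K0 KP] := horner_le_expR ('X^2 * p) ltr01.
exists K => t; rewrite /flat; case: ifPn => [t0|_]; last first.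
  by rewrite normr0 mulr_ge0// sqr_ge0.
have ti0 : 0 <= t^-1 by rewrite invr_ge0 ltW.
have := KP _ ti0; rewrite mul1r hornerM hornerXn normrM (ger0_norm (exprn_ge0 2
  ti0)).
rewrite exprVn ler_pdivrMl ?exprn_gt0// => H.
rewrite normrM [`|expR _|]ger0_norm ?expR_ge0// expRN ler_pdivrMr ?expR_gt0//.
by rewrite (le_trans H)// mulrCA mulrA mulrAC.
Qed.

Lemma is_derive_quadratic (f : R -> R) (K : R) :
  (forall t, `|f t| <= K * t ^+ 2) -> is_derive (0 : R) (1 : R) f 0.
Proof.
move=> fK; have f0 : f 0 = 0.
  by apply/eqP; rewrite -normr_le0 (le_trans (fK 0))// expr0n mulr0.
have H : h^-1 *: ((f \o shift 0) (h *: 1) - f 0) @[h --> (0 : R)^'] --> (0 : R).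
  apply/cvgrPdist_le => e e0; near=> h.
  have hn0 : h != 0 by near: h; exact: nbhs_dnbhs_neq.
  rewrite sub0r normrN /= f0 subr0 addr0 [h *: 1]mulr1.
  rewrite /GRing.scale /= normrM normfV ler_pdivrMl ?normr_gt0//.
  rewrite (le_trans (fK h))// sqr_normr_mul mulrCA ler_wpM2l//.
  have K0 : 0 < `|K| + 1 by rewrite ltr_wpDl.
  apply: (@le_trans _ _ ((`|K| + 1) * `|h|)).
    by rewrite ler_wpM2r// (le_trans (ler_norm K))// lerDl.
  rewrite -ler_pdivlMl// mulrC ltW//; near: h; apply: dnbhs0_lt.
  by rewrite divr_gt0.
apply: DeriveDef; first by apply/cvg_ex; exists 0.
by rewrite /derive; exact: cvg_lim H.
Unshelve. all: by end_near. Qed.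

(** For [t > 0], with [s = t^-1], the derivative of [s] is [- s^2], so that of [p(s) exp(-s)] is
    [s^2 (p(s) - p'(s)) exp(-s)]. *)
Lemma is_derive_flat p t :
  is_derive t (1 : R) (flat p) (flat ('X^2 * (p - p^`())) t).
Proof.
have [t0|t0|->] := ltgtP t 0.
- rewrite (flat_le0 _ (ltW t0)).
  apply: (@near_eq_is_derive _ _ _ (cst 0)).
  have : nbhs t [set s | s < 0] by apply: open_nbhs_nbhs; split => //;
    exact: open_lt.
  by apply: filterS => s /= s0; rewrite (flat_le0 _ (ltW s0)).
- rewrite (flat_gt0 _ t0).
  apply: (@near_eq_is_derive _ _ _ (fun s => p.[s^-1] * expR (- s^-1))).
    have : nbhs t [set s | 0 < s] by apply: open_nbhs_nbhs; split => //;
      exact: open_gt.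
    by apply: filterS => s /= s0; rewrite flat_gt0.
  have tn0 : t != 0 by rewrite gt_eqF.
  have di : is_derive t (1 : R) (fun s : R => s^-1) (- t ^- 2).
    have := @is_deriveV R id t 1 1 tn0 (is_derive_id t (1 : R)).
    by move/is_derive_eq; apply; rewrite /GRing.scale /= mulr1.
  have d1 := is_derive1_comp (is_derive_poly p t^-1) di.
  have d2 := is_derive_expR_comp (is_deriveN di).
  have := is_derive_mul d1 d2.
  move/is_derive_eq; apply.
  rewrite hornerM hornerXn hornerD hornerN -?exprVn !fctE /=; ring.
- rewrite (flat_le0 _ (lexx 0)); have [K KP] := flat_quadratic p.
  exact: is_derive_quadratic KP.
Qed.

Lemma flat1_gt0 t : (0 < flat 1 t) = (0 < t).
Proof. by rewrite /flat; case: ifPn => [_|]; rewrite ?ltxx//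
  hornerC mul1r expR_gt0. Qed.

Lemma flat1_ge0 t : 0 <= flat 1 t.
Proof. by rewrite /flat; case: ifPn => // _;
  rewrite hornerC mul1r expR_ge0. Qed.

End flat_functions.

(** * Stability of C^k functions and construction of bumps *)

Section smooth_functions.
Context {R : realType} {d : nat}.
Implicit Types (f g Q : 'rV[R]_d -> R).

Lemma partial_is_derive i f (df : 'rV[R]_d -> R) :
  (forall x, is_derive x ('e_i : 'rV[R]_d) f (df x)) -> partial i f = df.
Proof. by move=> H; apply/funext => x; have [_] := H x. Qed.

Lemma partialP i f x : differentiable f x ->
  is_derive x ('e_i : 'rV[R]_d) f (partial i f x).
Proof. by move=> df; apply: derivableP; exact: diff_derivable. Qed.

Lemma CkW k f : Ck k.+1 f -> Ck k f.
Proof.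
elim: k f => [|k IH] f; first exact: CkS_continuous.
by move=> [df pf]; split=> // i; exact: IH.
Qed.

Lemma Ck_cst k (a : R) : Ck k (fun _ : 'rV[R]_d => a).
Proof.
elim: k a => [|k IH] a; first exact: continuous_cst.
split=> [x|i]; first exact: differentiable_cst.
by rewrite (@partial_is_derive _ _ (fun=> 0)); exact: IH.
Qed.

Lemma Ck_coord k j : Ck k (fun x : 'rV[R]_d => x 0 j).
Proof.
case: k => [|k]; first exact: coord_continuous.
split=> [x|i]; first exact: differentiable_coord.
suff -> : partial i (fun x : 'rV[R]_d => x 0 j) = (fun=> ('e_i : 'rV[R]_d) 0 j).
  exact: Ck_cst.
apply: partial_is_derive => x; apply: DeriveDef;
  first exact/diff_derivable/differentiable_coord.
(* The coordinate is packed as a linear map, since a continuous linear map is its own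
   differential. *)
have [f fE] : exists f : {linear 'rV[R]_d -> R}, f = (fun x : 'rV[R]_d =>
  x 0 j) :> (_ -> _).
  have lin : linear (fun x : 'rV[R]_d => x 0 j) by move=> a y z; rewrite !mxE.
  pose mf := GRing.isLinear.Build _ _ _ _ _ lin.
  by exists (HB.pack (fun x : 'rV[R]_d => x 0 j) mf : {linear 'rV[R]_d -> R}).
rewrite deriveE; last exact: differentiable_coord.
by rewrite -fE diff_lin; rewrite fE //; exact: coord_continuous.
Qed.

Lemma partialD i f g : (forall x, differentiable f x) -> (forall x,
  differentiable g x) ->
  partial i (fun x => f x + g x) = (fun x => partial i f x + partial i g x).
Proof.
move=> df dg; apply: partial_is_derive => x.
exact: is_deriveD (partialP i (df x)) (partialP i (dg x)).
Qed.

Lemma partialM i f g : (forall x, differentiable f x) -> (forall x,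
  differentiable g x) ->
  partial i (fun x => f x * g x) = (fun x =>
    partial i f x * g x + f x * partial i g x).
Proof.
move=> df dg; apply: partial_is_derive => x.
have := is_deriveM (partialP i (df x)) (partialP i (dg x)).
by move/is_derive_eq; apply; rewrite /GRing.scale /= addrC mulrC.
Qed.

Lemma CkD k f g : Ck k f -> Ck k g -> Ck k (fun x => f x + g x).
Proof.
elim: k f g => [|k IH] f g; first exact: continuous_add.
move=> [df pf] [dg pg]; split=> [x|i]; first exact: differentiableD.
by rewrite partialD//; apply: IH; [exact: pf|exact: pg].
Qed.

Lemma CkM k f g : Ck k f -> Ck k g -> Ck k (fun x => f x * g x).
Proof.
elim: k f g => [|k IH] f g; first exact: continuous_mul.
move=> Cf Cg; have [df pf] := Cf; have [dg pg] := Cg.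
split=> [x|i]; first exact: differentiableM.
rewrite partialM//; apply: CkD; [apply: IH (pf i) _|apply: IH _ (pg i)];
  exact: CkW.
Qed.

Lemma Ck_sum k (I : Type) (r : seq I) (F : I -> 'rV[R]_d -> R) :
  (forall i, Ck k (F i)) -> Ck k (fun x => \sum_(i <- r) F i x).
Proof.
move=> CF; elim: r => [|i r IH].
  by rewrite (_ : (fun x => _) = fun=> 0); [exact: Ck_cst|
    apply/funext => x; rewrite big_nil].
rewrite (_ : (fun x => _) = fun x => F i x + \sum_(i <- r) F i x);
  first exact: CkD.
by apply/funext => x; rewrite big_cons.
Qed.

(** A partial derivative is again of the form [flat q (Q x)] times a smooth function, with another
    polynomial [q]; the induction on [k] is therefore over all [p]. *)
Lemma Ck_flat k p Q : Cinfty Q -> Ck k (fun x => flat p (Q x)).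
Proof.
move=> CQ; have dQ := Cinfty_differentiable CQ.
elim: k p => [|k IH] p.
  apply: continuous_fun_comp (Cinfty_continuous CQ) _.
  exact: is_derive_continuous (is_derive_flat p).
have dp t : differentiable (flat p) t.
  by apply/derivable1_diffP; have [] := is_derive_flat p t.
split=> [x|i]; first exact: differentiable_comp.
suff -> : partial i (fun x => flat p (Q x)) =
    (fun x => flat ('X^2 * (p - p^`())) (Q x) * partial i Q x).
  by apply: CkM => //; exact: Cinfty_partial.
apply: partial_is_derive => x; have dc : differentiable (flat p \o Q) x
  by exact: differentiable_comp.
apply: DeriveDef; first exact: diff_derivable.
rewrite [LHS]deriveE// diff_comp//= -(deriveE _ (dQ x)) -/(partial i Q x).
rewrite deriv1E /=; last by have [] := is_derive_flat p (Q x).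
rewrite derive1E; have [_ ->] := is_derive_flat p (Q x).
by rewrite /GRing.scale /= mulrC.
Qed.

(** The squared Euclidean distance is used because it is polynomial, unlike the maximum norm; the
    Euclidean ball of radius [r] lies in the cube of the same radius. *)
Definition bump_fun (a : 'rV[R]_d) (r : R) (x : 'rV[R]_d) : R :=
  flat 1 (r ^+ 2 - \sum_i (x 0 i - a 0 i) ^+ 2).

Lemma bump_Cinfty a r : Cinfty (bump_fun a r).
Proof.
move=> k; apply: (@Ck_flat k 1 (fun x => r ^+ 2 - \sum_i (x 0 i - a 0 i) ^+ 2))
  => j.
apply: CkD; first exact: Ck_cst.
rewrite (_ : (fun x => _) =
    fun x : 'rV[R]_d => \sum_i (-1 * ((x 0 i + - a 0 i) * (x 0 i + - a 0 i)))).
  apply: Ck_sum => i; apply: CkM; first exact: Ck_cst.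
  by apply: CkM; (apply: CkD; [exact: Ck_coord|exact: Ck_cst]).
by apply/funext => x; rewrite -sumrN; apply: eq_bigr => i _;
  rewrite mulN1r -expr2.
Qed.

Lemma bump_ge0 a r x : 0 <= bump_fun a r x. Proof. exact: flat1_ge0. Qed.

Lemma bump_center_gt0 a r : 0 < r -> 0 < bump_fun a r a.
Proof.
move=> r0; rewrite flat1_gt0 big1 ?subr0 ?exprn_gt0// => i _.
by rewrite subrr expr0n.
Qed.

Lemma bump_gt0_near a r x : 0 < r -> 0 < bump_fun a r x -> `|x - a| <= r.
Proof.
move=> r0; rewrite flat1_gt0 subr_gt0 => H; apply: norm_le_coord => [|i];
  first exact: ltW.
rewrite !mxE -(@ler_pXn2r _ 2%N) ?nnegrE ?(ltW r0)// real_normK ?num_real//.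
rewrite (le_trans _ (ltW H))// (bigD1 i)//= lerDl.
by apply: sumr_ge0 => j _; exact: sqr_ge0.
Qed.

Lemma supported_compactly M f : supported_in M f -> compactly_supported f.
Proof.
move=> fM; apply: bounded_closed_compact; last exact: closed_closure.
have cM : closed (@cube R d M).
  by apply: closed_comp (@closed_le R M) => // x _; exact: norm_continuous.
have sub : closure [set x | f x != 0] `<=` @cube R d M.
  rewrite [X in _ `<=` X]((closure_id (@cube R d M)).1 cM).
  apply: closureS => x /= fx; rewrite /cube /= leNgt.
  by apply: contra fx => /fM ->.
exists M; split; first exact: num_real.
by move=> r Mr x /sub xM; exact: le_trans xM (ltW Mr).
Qed.

Lemma bump_supported a r : 0 < r -> supported_in (`|a| + r) (bump_fun a r).
Proof.
move=> r0 x xr; apply/eqP; apply: contraTT xr => bx; rewrite -leNgt.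
have /(bump_gt0_near r0) : 0 < bump_fun a r x
  by rewrite lt_neqAle eq_sym bx bump_ge0.
move=> xa; apply: (@le_trans _ _ `|a + (x - a)|); first by rewrite subrKC.
by rewrite (le_trans (ler_normD _ _))// lerD2l.
Qed.

End smooth_functions.

(** * Integration by parts *)

Section integration_by_parts.
Context {R : realType} {d : nat}.
Implicit Types (f k phi sigma u : 'rV[R]_d -> R) (M : R).

Lemma integral_partial_eq0 M f i : Ck 1 f -> supported_in M f ->
  \int[@rV_lebesgue R d]_x partial i f x = 0.
Proof.
move=> [df cpf] fM; have pM := supported_partial i fM.
rewrite /Rintegral (integral_eq0_along_coordinate (cpf i) pM (i := i)) // => x.
have cl : continuous (fun s : R => x + s *: 'e_i : 'rV[R]_d).
  exact: is_derive_continuous (is_derive_line x 'e_i).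
have far (t : R) : M + `|x| < `|t| -> M < `|x + t *: 'e_i|.
  by move=> tM; rewrite (lt_le_trans _ (norm_line_ge _ _ _))// ltrBrDr.
apply: (integral_derivative_eq0 (Q := fun t : R => f (x + t *: 'e_i)) (T :=
  M + `|x|)).
- exact: continuous_fun_comp cl (cpf i).
- by move=> t; exact: is_derive_partial.
- by move=> t /far/pM.
- by move=> t /far/fM.
Qed.

Lemma integral_sum_eq0 M (I : Type) (r : seq I) (F : I -> 'rV[R]_d -> R) :
  (forall i, continuous (F i)) -> (forall i, supported_in M (F i)) ->
  (forall i, \int[@rV_lebesgue R d]_x F i x = 0) ->
  \int[@rV_lebesgue R d]_x (\sum_(i <- r) F i x) = 0.
Proof.
move=> cF FM F0; elim: r => [|i r IH].
  by under eq_Rintegral => x _ do rewrite big_nil; rewrite Rintegral_cst//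
    mul0r.
under eq_Rintegral => x _ do rewrite big_cons.
rewrite (integral_supportedD (M := M) (M' := M)) ?F0 ?IH ?addr0//.
  exact: continuous_sum.
by move=> x Mx; rewrite big1// => j _; exact: FM.
Qed.

Lemma integral_test_divergence (g : 'I_d -> 'rV[R]_d -> R) phi M :
  (forall i, Ck 1 (g i)) -> Cinfty phi -> supported_in M phi ->
  \int[@rV_lebesgue R d]_x (\sum_i g i x * partial i phi x) =
  - \int[@rV_lebesgue R d]_x (phi x * \sum_i partial i (g i) x).
Proof.
move=> Cg Cphi phiM; have dg i x : differentiable (g i) x by have [] := Cg i.
have cpg i : continuous (partial i (g i)) by have [_] := Cg i; exact.
have cg i : continuous (g i) := CkS_continuous (Cg i).
have dphi := Cinfty_differentiable Cphi.
have cphi := Cinfty_continuous Cphi.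
have cpphi i := Cinfty_continuous (Cinfty_partial i Cphi).
have pE i : partial i (fun x => g i x * phi x) =
    fun x => g i x * partial i phi x + phi x * partial i (g i) x.
  by rewrite partialM//; apply/funext => x; ring.
have C1 i : Ck 1 (fun x => g i x * phi x) by apply: CkM;
  [exact: Cg|exact: Cphi].
have c1 : continuous (fun x => \sum_i g i x * partial i phi x).
  by apply: continuous_sum => i; exact: continuous_mul.
have c2 : continuous (fun x => phi x * \sum_i partial i (g i) x).
  by apply: continuous_mul => //; exact: continuous_sum.
have s1 : supported_in M (fun x => \sum_i g i x * partial i phi x).
  by move=> x Mx; rewrite big1// => i _; rewrite (supported_partial i phiM)
    ?mulr0.
have s2 := supported_mulr (fun x => \sum_i partial i (g i) x) phiM.
apply/eqP; rewrite -addr_eq0 -(integral_supportedD c1 c2 s1 s2); apply/eqP.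
have -> : (fun x => \sum_i g i x * partial i phi x + phi x * \sum_i partial i
  (g i) x) =
    (fun x => \sum_i partial i (fun x => g i x * phi x) x).
  by apply/funext => x; rewrite mulr_sumr -big_split; apply: eq_bigr => i _;
    rewrite pE.
have gphiM i : supported_in M (fun x => g i x * phi x).
  by move=> x Mx; rewrite phiM// mulr0.
apply: (@integral_sum_eq0 M) => i.
- by have [_] := C1 i; exact.
- exact: supported_partial.
- exact: integral_partial_eq0 (C1 i) (gphiM i).
Qed.

(** By continuity [f] is at least [f a / 2] on a small closed cube around [a], whose volume is
    positive by the formula for boxes. *)
Lemma positive_integral f M a : continuous f -> supported_in M f ->
  (forall x, 0 <= f x) -> 0 < f a -> 0 < \int[@rV_lebesgue R d]_x f x.
Proof.
move=> cf fM f0 fa.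
have fi := continuous_supported_integrable cf fM.
have mf := measurable_int _ fi.
have fa2 : 0 < f a / 2 by rewrite divr_gt0.
have [e /= e0 eP] : exists2 e : R, 0 < e & forall x, `|x - a| <= e ->
  f a / 2 <= f x.
  have : \forall x \near a, f a / 2 < f x.
    by apply: (cvgr_gt (f a) (cf a)); rewrite ltr_pdivrMr// ltr_pMr// ltr1n.
  move=> /nbhs_ballP[e /= e0 eP]; exists (e / 2); first by rewrite divr_gt0.
  move=> x xa; apply/ltW/eP; rewrite -ball_normE /= distrC.
  by rewrite (le_lt_trans xa)// ltr_pdivrMr// ltr_pMr// ltr1n.
pose box := [set x : 'rV[R]_d | forall i,
  (a - const_mx e) 0 i <= x 0 i <= (a + const_mx e) 0 i].
have boxE : box = [set x | `|x - a| <= e].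
  apply/seteqP; split=> x /= xe.
    apply: norm_le_coord => [|i]; first exact: ltW.
    by have := xe i; rewrite !mxE ler_distl.
  move=> i; have := norm_coord_le (x - a) i; rewrite !mxE => /le_trans/(_ xe).
  by rewrite ler_distl.
have mbox : measurable box.
  have -> : box = ~` [set x | e < `|x - a|].
    by rewrite boxE; apply/seteqP; split=> x /=; rewrite leNgt; move/negP.
  apply: measurableC; apply: open_measurable_rV.
  have cn : continuous (fun x : 'rV[R]_d => `|x - a|).
    apply: (@lipschitz_continuous R _ _ _ 1) => x y; rewrite mul1r.
    by rewrite (le_trans (ler_dist_dist _ _))// opprB addrA subrK.
  by apply: open_comp (@open_gt R e) => // x _; exact: cn.
have volE : @rV_lebesgue R d box = (\prod_(i < d) (e + e))%:E.
  rewrite rV_lebesgue_box => [|i]; last by rewrite !mxE lerBlDr -addrA lerDl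
    addr_ge0 ?ltW.
  by congr EFin; apply: eq_bigr => i _; rewrite !mxE; ring.
have lb : ((f a / 2)%:E * @rV_lebesgue R d box <= \int[@rV_lebesgue R d]_x (f
  x)%:E)%E.
  rewrite -integral_cst//.
  apply: (@le_trans _ _ (\int[@rV_lebesgue R d]_(x in box) (f x)%:E)%E).
    apply: ge0_le_integral => //.
    - by move=> x _; rewrite lee_fin ltW.
    - exact: (measurable_funS measurableT _ mf).
    - by move=> x; rewrite boxE => /eP; rewrite lee_fin.
  by apply: ge0_subset_integral => // x _; rewrite lee_fin.
rewrite -lte_fin /Rintegral fineK ?integrable_fin_num//.
apply: lt_le_trans lb; rewrite volE -EFinM lte_fin mulr_gt0//.
by apply: prodr_gt0 => i _; rewrite addr_gt0.
Qed.

(** Where [k] is positive, a bump supported in a small enough neighbourhood gives a positive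
    integral; where it is negative, the same argument applies to [-1 * k]. *)
Lemma test_functions_separate k : continuous k ->
  (forall phi, Cinfty phi -> compactly_supported phi ->
    \int[@rV_lebesgue R d]_x (phi x * k x) = 0) ->
  forall x, k x = 0.
Proof.
have H (h : 'rV[R]_d -> R) a : continuous h -> 0 < h a ->
    exists2 phi, Cinfty phi /\ compactly_supported phi &
      0 < \int[@rV_lebesgue R d]_x (phi x * h x).
  move=> ch ha; have : \forall x \near a, 0 < h x.
    exact: (cvgr_gt (h a) (ch a)).
  move=> /nbhs_ballP[e /= e0 eP]; have e20 : 0 < e / 2 by rewrite divr_gt0.
  have bM := bump_supported (a := a) e20.
  have cb := Cinfty_continuous (bump_Cinfty a (e / 2)).
  exists (bump_fun a (e / 2)).
    by split; [exact: bump_Cinfty|exact: supported_compactly bM].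
  apply: (positive_integral (continuous_mul cb ch) (supported_mulr h bM) (a :=
    a)).
    move=> x; have := bump_ge0 a (e / 2) x; rewrite le_eqVlt => /predU1P[<-|b0].
      by rewrite mul0r.
    rewrite mulr_ge0 ?ltW//; apply: eP; rewrite -ball_normE /= distrC.
    rewrite (le_lt_trans (bump_gt0_near e20 b0))//.
    by rewrite ltr_pdivrMr// ltr_pMr// ltr1n.
  by rewrite mulr_gt0// bump_center_gt0.
move=> ck k0 x; apply/eqP; rewrite eq_le; apply/andP; split; rewrite leNgt;
  apply/negP => kx.
  by have [phi [C1 C2]] := H k x ck kx; rewrite k0// ltxx.
have ck' : continuous (fun x => -1 * k x).
  by apply: continuous_mul => //; exact: continuous_cst.
have kx' : 0 < -1 * k x by rewrite mulN1r oppr_gt0.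
have [phi [C1 C2]] := H _ x ck' kx'.
have [M phiM] := compactly_supported_supported C2.
have -> : (fun x => phi x * (-1 * k x)) = (fun x => -1 * (phi x * k x)).
  by apply/funext => y; ring.
rewrite (integral_supportedZ _ (continuous_mul (Cinfty_continuous C1) ck)
  (supported_mulr k phiM)).
by rewrite k0// mulr0 ltxx.
Qed.

Lemma realizable_C1_pointwise u sigma : Ck 2 u -> Ck 1 sigma ->
  isotropically_realizable (grad u) sigma ->
  forall x, dotp (grad sigma x) (grad u x) + sigma x * laplacian u x = 0.
Proof.
move=> [du Cpu] Csigma realizable; pose g i x := sigma x * partial i u x.
have Cg i : Ck 1 (g i) by apply: CkM => //; exact: Cpu.
have dsigma x : differentiable sigma x by have [] := Csigma.
have dpu i x : differentiable (partial i u) x by have [] := Cpu i.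
have divE x : \sum_i partial i (g i) x =
    dotp (grad sigma x) (grad u x) + sigma x * laplacian u x.
  rewrite /laplacian mulr_sumr -big_split /=; apply: eq_bigr => i _.
  by rewrite /g partialM// !mxE.
have cdiv : continuous (fun x => \sum_i partial i (g i) x).
  by apply: continuous_sum => i; have [_] := Cg i; exact.
move=> x; rewrite -divE; move: x; apply: test_functions_separate => //
  phi Cphi phic.
have [M phiM] := compactly_supported_supported phic.
apply/eqP; rewrite -oppr_eq0 -(integral_test_divergence Cg Cphi phiM).
have := realizable phi Cphi phic.
under eq_Rintegral => x _ do rewrite mulr_sumr.
move=> I0; apply/eqP; rewrite -[RHS]I0; apply: eq_Rintegral => x _;
  apply: eq_bigr => i _.
by rewrite /g !mxE mulrA.
Qed.

End integration_by_parts.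

(** * Bounded periodic functions as elements of the essentially bounded class *)

Section essentially_bounded_periodic.
Context {R : realType} {d : nat} (B : 'M[R]_d).

Lemma bounded_Linfty_per (f : 'rV[R]_d -> R) (K : R) :
  measurable_fun [set: 'rV[R]_d] (f : 'rV[R]_d -> measurableTypeR R) ->
  (forall x, `|f x| <= K) -> Y_periodic B f -> Linfty_per B f.
Proof.
move=> mf fK pf; split => //; rewrite unlock; case: ifPn => _; last exact: ltry.
apply: (@le_lt_trans _ _ K%:E); last exact: ltry.
by apply/ess_sup_inf.ess_supP; apply: aeW => x /=; rewrite lee_fin.
Qed.

End essentially_bounded_periodic.

(** * The integral of the Laplacian along flow lines *)

Section flow_integrals.
Context {R : realType} {d : nat} (X : R -> 'rV[R]_d -> 'rV[R]_d)
  (v : 'rV[R]_d -> 'rV[R]_d) (l : 'rV[R]_d -> R).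
Hypothesis flow0 : forall x, X 0 x = x.
Hypothesis flow_solution : forall x, solution v (X ^~ x).

Definition flow_integral (t : R) x := oriented_integral 0 t (fun s =>
  l (X s x)).

Lemma flow_integral0 x : flow_integral 0 x = 0.
Proof. by rewrite /flow_integral /oriented_integral lexx set_itv1
  Rintegral_set1. Qed.

Lemma is_derive_flow_integral : continuous l -> forall x (t : R),
  is_derive t (1 : R) (flow_integral ^~ x) (l (X t x)).
Proof.
move=> cl x t; apply: is_derive_oriented_integral.
exact: continuous_fun_comp (is_derive_continuous (flow_solution x)) cl.
Qed.

Lemma log_along_flow (sigma : 'rV[R]_d -> R) (A : R -> 'rV[R]_d -> R) :
  (forall x, differentiable sigma x) -> (forall x, 0 < sigma x) ->
  (forall x, dotp (grad sigma x) (v x) + sigma x * l x = 0) ->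
  (forall x (t : R), is_derive t (1 : R) (A ^~ x) (l (X t x))) ->
  (forall x, A 0 x = 0) ->
  forall t x, A t x = ln (sigma x) - ln (sigma (X t x)).
Proof.
move=> ds s0 eqn dA A0 t x.
have D (r : R) : is_derive r (1 : R) (fun r => sigma (X r x) * expR (A r x)) 0.
  have d1 := is_derive_along (ds (X r x)) (flow_solution x r).
  have := is_derive_mul d1 (is_derive_expR_comp (dA x r)).
  by move/is_derive_eq; apply; rewrite /comp /= mulrA -mulrDl eqn mul0r.
have := derive_eq0_constant D t 0; rewrite /= flow0 A0 expR0 mulr1 => <-.
by rewrite lnM ?posrE ?expR_gt0// expRK addrC addKr.
Qed.

End flow_integrals.

(** * The time to reach the zero level *)

Section time_to_zero_level.
Context {R : realType} {d : nat} (u : 'rV[R]_d -> R)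
  (X : R -> 'rV[R]_d -> 'rV[R]_d) (tau : 'rV[R]_d -> R)
  (A : R -> 'rV[R]_d -> R).
Hypothesis du : forall x, differentiable u x.
Hypothesis gradu_neq0 : forall x, grad u x != 0.
Hypothesis flow_solution : forall x, solution (grad u) (X ^~ x).
Hypothesis flow_addX : forall s t x, X (t + s) x = X t (X s x).
Hypothesis tauP : forall x, u (X (tau x) x) = 0.

Lemma potential_increasing x : {homo (fun t => u (X t x)) : s t / s < t}.
Proof.
apply: (@derive_gt0_increasing _ _ (fun t =>
  dotp (grad u (X t x)) (grad u (X t x)))).
  by move=> t; exact: is_derive_along (du _) (flow_solution x t).
by move=> t; exact: dotp_gt0.
Qed.

(** The potential is strictly increasing along a flow line, so each line meets the zero level at one
    time only. *)
Lemma tau_flow t x : tau (X t x) = tau x - t.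
Proof.
apply/eqP; rewrite -subr_eq opprK; have := tauP (X t x).
rewrite -flow_addX => E; case: (ltgtP (tau (X t x) + t) (tau x)) => // lt.
  by have := potential_increasing x lt; rewrite E tauP ltxx.
by have := potential_increasing x lt; rewrite E tauP ltxx.
Qed.

(** [x] and [X t x] reach the zero level at the same point, so [A t x] is the difference of their
    two integrals up to that point, each at most [C]. *)
Lemma integral_bound_all_times (C : R) :
  (forall s t x, A (t + s) x = A t (X s x) + A s x) ->
  (forall x, `|A (tau x) x| <= C) -> forall t x, `|A t x| <= C + C.
Proof.
move=> A_add AC t x; have := A_add t (tau x - t) x.
rewrite subrK -tau_flow => E; have -> : A t x = A (tau x) x - A (tau (X t x))
  (X t x).
  by rewrite E addrC addKr.
by rewrite (le_trans (ler_normB _ _))// lerD.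
Qed.

End time_to_zero_level.

(** * Bounded flow integrals and realizability: the two implications *)

Theorem theorem2p16 (R : realType) (d : nat) (a : 'rV[R]_d) (B : 'M[R]_d)
    (u : 'rV[R]_d -> R) (X : R -> 'rV[R]_d -> 'rV[R]_d) (tau : 'rV[R]_d -> R) :
  (2 <= d)%N ->
  B \in unitmx ->
  Ck 3 u ->
  Y_periodic B (grad u) ->
  average (parallelepiped a B) (grad u) != 0 ->
  (forall x, grad u x != 0) ->
  is_gradient_flow u X ->
  (forall x, u (X (tau x) x) = 0) ->
  ((exists2 C : R, 0 < C & forall x,
      `|oriented_integral 0 (tau x) (fun t => laplacian u (X t x))| <= C) ->
   exists sigma : 'rV[R]_d -> R,
     [/\ forall x, 0 < sigma x,
         Linfty_per B sigma,
         Linfty_per B (fun x => (sigma x)^-1) &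
         isotropically_realizable (grad u) sigma])
  /\
  ((exists sigma : 'rV[R]_d -> R,
     [/\ forall x, 0 < sigma x,
         C1_per B sigma &
         isotropically_realizable (grad u) sigma]) ->
   exists2 C : R, 0 < C & forall x,
      `|oriented_integral 0 (tau x) (fun t => laplacian u (X t x))| <= C).
Proof.
move=> _ uB Cu pu _ gu0 flowX tauP.
have [C C0 [vC vL wC lC lL]] := periodic_C3_bounds uB Cu pu.
have [du Cpu] := Cu.
have flow0 x : X 0 x = x by have [] := flowX x.
have sol x : solution (grad u) (X ^~ x) by move=> t; have [_] := flowX x; exact.
have flow_addX := flow_add C0 vL flow0 sol.
have cl : continuous (laplacian u) := lipschitz_continuous lL.
pose A := flow_integral X (laplacian u).
have A0 : forall x, A 0 x = 0 by exact: flow_integral0.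
have dA : forall x (t : R), is_derive t (1 : R) (A ^~ x) (laplacian u (X t x)).
  exact: is_derive_flow_integral sol cl.
have AE x : oriented_integral 0 (tau x) (fun t =>
  laplacian u (X t x)) = A (tau x) x by [].
(* From here on [A] is known only through its derivative in time and its value at time [0]. *)
clearbody A.
have A_add := flow_integral_add C0 vL flow0 sol dA A0.
have pl := laplacian_periodic pu.
split; last first.
  move=> [sigma [s0 [Cs ps] realizable]].
  have Cu2 : Ck 2 u := CkW Cu.
  have eqn := realizable_C1_pointwise Cu2 Cs realizable.
  have ds : forall x, differentiable sigma x by have [] := Cs.
  have logE := log_along_flow flow0 sol ds s0 eqn dA A0.
  have cln : continuous (fun x => ln (sigma x)).
    move=> x; have cs : {for x, continuous sigma}
      by exact: differentiable_continuous.
    exact: (continuous_comp cs (continuous_ln (s0 x))).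
  have pln : Y_periodic B (fun x => ln (sigma x)) by move=> x i; rewrite ps.
  have [K KP] := continuous_periodic_bounded uB cln pln.
  have K0 : 0 <= K := le_trans (normr_ge0 _) (KP 0).
  (* The summand [1] keeps the constant positive even when [K] is [0]. *)
  exists (K + K + 1) => [|x]; first by rewrite ltr_wpDl// addr_ge0.
  rewrite AE logE (le_trans (ler_normB _ _))// (@le_trans _ _ (K + K))//.
    by rewrite lerD.
  by rewrite lerDl.
move=> [D D0 DP].
have AD x : `|A (tau x) x| <= D by rewrite -AE.
have Ac := integral_bound_all_times du gu0 sol flow_addX tauP A_add AD.
pose sigma x := expR (wsup A 0 x).
have ww i x (t : R) : is_derive t (1 : R) (fun s : R =>
  grad u (x + s *: 'e_i) 0 i)
    (partial i (partial i u) (x + t *: 'e_i)).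
  have -> : (fun s : R => grad u (x + s *: 'e_i) 0 i) =
      (fun s : R => partial i u (x + s *: 'e_i)) by apply/funext => s;
        rewrite mxE.
  exact: is_derive_partial (Cpu i).1.
have wc i : continuous (partial i (partial i u)).
  by have [_ c2] := Cpu i; exact: (CkS_continuous (k := 0) (c2 i)).
have s0 x : 0 <= wsup A 0 x by apply: (wsup_ge0 Ac A0).
have sD x : wsup A 0 x <= D + D by apply: (wsup_le_bound Ac).
(* The flow commutes with lattice translations and the Laplacian is periodic, so every [A t] is
   periodic; no level of [u] is involved. *)
have ps : Y_periodic B (wsup A 0).
  move=> x i; apply: wsup_eq => t.
  apply: (flow_integral_translate C0 vL flow0 sol dA A0) => y; first exact: pu.
  exact: pl.
exists sigma; split.
- by move=> x; exact: expR_gt0.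
- apply: (@bounded_Linfty_per _ _ _ _ (expR (D + D))).
  + exact: measurable_wsup0 C0 vL lL flow0 sol dA A0 Ac _ (@continuous_expR R).
  + by move=> x; rewrite ger0_norm ?expR_ge0// ler_expR.
  + by move=> x i; rewrite /sigma ps.
(* Time [0] makes the supremum nonnegative, hence [sigma >= 1]. *)
- apply: (@bounded_Linfty_per _ _ _ _ 1).
  + apply: (measurable_wsup0 C0 vL lL flow0 sol dA A0 Ac (f := fun r =>
    (expR r)^-1)).
    move=> r; apply: cvgV; first by rewrite gt_eqF// expR_gt0.
    exact: continuous_expR.
  + move=> x; rewrite ger0_norm ?invr_ge0 ?expR_ge0// invf_le1 ?expR_gt0//.
    by rewrite -expR0 ler_expR.
  + by move=> x i; rewrite /sigma ps.
- exact: (wsup_realizable C0 vC vL wC wc ww (fun=>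
  erefl) lC lL flow0 sol dA A0 Ac).
Qed.
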